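(* Let $\mu_0\in\mathcal P_2(\mathbb R)$ and $\nu := \sum_{j=1}^n w_j\delta_{x_j}$ with weights $0<w_j\le 1$ fulfilling $\sum_{j=1}^n w_j=1$ and $x_1<x_2<\dots<x_n$. Put $W_k := \sum_{j=1}^k w_j$ for $k=0,\dots,n$, $x_0:=-\infty$, $x_{n+1}:=\infty$. For $s\in(0,1)\setminus\{W_1,\dots,W_{n-1}\}$ let $\ell_s$ be the index with $W_{\ell_s-1}<s<W_{\ell_s}$ and define the following quantities. (a) If $Q_{\mu_0}(s)\le Q_\nu(s)$: $k_s$ is the index with $x_{k_s}\le Q_{\mu_0}(s)<x_{k_s+1}$; $x_{s,j}:=x_{k_s+j}$ for $j=1,\dots,|\ell_s-k_s|$; $R_{s,j}:=W_{k_s+j}$ for $j=0,\dots,|\ell_s-k_s|-1$. (b) If $Q_{\mu_0}(s)\ge Q_\nu(s)$: $k_s$ is the index with $x_{k_s-1}<Q_{\mu_0}(s)\le x_{k_s}$; $x_{s,j}:=x_{k_s-j}$ for $j=1,\dots,|\ell_s-k_s|$; $R_{s,j}:=W_{k_s-j-1}$ for $j=0,\dots,|\ell_s-k_s|-1$. Further let $$t_{s,0}:=0,\qquad t_{s,1}:=\frac{x_{s,1}-Q_{\mu_0}(s)}{2(s-R_{s,0})},\qquad t_{s,j+1}:=t_{s,j}+\frac{x_{s,j+1}-x_{s,j}}{2(s-R_{s,j})},\quad j\in\{1,\dots,|\ell_s-k_s|-1\}.$$ Then the strong solution of the Cauchy problem $$\partial_t g(t) \in -\partial F_\nu(g(t)),\quad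 t\in(0,\infty),\qquad g(0)=Q_{\mu_0},$$ where $F_\nu(u) = \int_0^1 \big( (1-2s)\,u(s) + \int_0^1 |u(s)-Q_\nu(t)|\,dt \big) ds$ on $L_2(0,1)$, is given by $$[g(t)](s) = \begin{cases} Q_{\mu_0}(s)+2(s-R_{s,0})\,t, & t\in[t_{s,0},t_{s,1}),\\ x_{s,j}+2(s-R_{s,j})(t-t_{s,j}), & t\in[t_{s,j},t_{s,j+1}),\ j\in\{1,\dots,|\ell_s-k_s|-1\},\\ Q_\nu(s), & t\ge t_{s,|\ell_s-k_s|}.\end{cases}$$ (If $\ell_s=k_s$ only the last case occurs, i.e. $[g(t)](s)=Q_\nu(s)$ for all $t\ge0$.)
   Context: $\mathcal P_2(\mathbb R)$ is the set of Borel probability measures on $\mathbb R$ with finite second moment. For a probability measure $\mu$ on $\mathbb R$: $R_\mu^+(x) := \mu((-\infty,x])$ and $Q_\mu(s) := \min\{x \in \mathbb R : R_\mu^+(x) \ge s\}$, $s\in(0,1)$. The function $g(t)\in L_2(0,1)$ is specified for all $s\in(0,1)$ outside the finite set $\{W_1,\dots,W_{n-1}\}$. The subdifferential is $\partial F(u) := \{ v \in L_2(0,1) : F(w) \ge F(u) + \langle v, w-u\rangle + o(\|w-u\|) \text{ for all } w \in L_2(0,1)\}$ (for convex $F$ the $o$-term can be omitted). A strong solution of the Cauchy problem is a function $g \colon [0,\infty)\to L_2(0,1)$ with $g \in W^1_1((0,T];L_2(0,1)) \cap C([0,\infty);L_2(0,1))$ for every $T>0$, satisfying the initial condition and, for a.e.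 $t>0$, the inclusion, where $\partial_t g(t)$ is the strong derivative; such a solution exists and is unique for every initial value $Q_{\mu_0}$, $\mu_0\in\mathcal P_2(\mathbb R)$. *)

(* Defs.v *)
From HB Require Import structures.
From mathcomp Require Import all_boot all_order all_algebra.
From mathcomp Require Import all_classical all_reals all_analysis.

Set Implicit Arguments.
Unset Strict Implicit.
Unset Printing Implicit Defensive.

Import Order.TTheory GRing.Theory Num.Theory.
Import numFieldNormedType.Exports.

Local Open Scope classical_set_scope.
Local Open Scope ring_scope.

Section L2.
Context {R : realType}.

Definition leb01 : {measure set (measurableTypeR R) -> \bar R} :=
  mrestr (@lebesgue_measure R) (measurable_itv `]0%R, 1%R[).

(* Elements are representatives: equality in L_2(0,1) is equality a.e. for
   leb01.  The values outside ]0, 1[ are irrelevant. *)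
Definition L2 := LfunType leb01 (lee1n 2).

Definition L2norm (u : L2) : R := fine ('N[leb01]_2%:E[EFin \o u])%E.

Definition L2dot (u v : L2) : R := \int[leb01]_s (u s * v s).

(* Frechet subdifferential: the inequality holds up to o(|w - u|) as w -> u. *)
Definition subdiff (F : L2 -> R) (u : L2) : set L2 :=
  [set v | forall eps, 0 < eps -> exists2 delta, 0 < delta &
     forall w : L2, L2norm (w - u) < delta ->
       F u + L2dot v (w - u) - eps * L2norm (w - u) <= F w].

End L2.

Arguments L2 R : clear implicits.

Section vector_valued.
Context {R : realType}.
Implicit Types (g f : R -> L2 R) (D : set R) (a b t T : R).

Definition simple_L2 f := exists m (A : 'I_m -> set (measurableTypeR R))
    (v : 'I_m -> L2 R),
  (forall i, measurable (A i)) /\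
  forall t, f t = \sum_(i < m) (\1_(A i) t : R) *: v i.

Definition strongly_measurable D f := exists f_ : nat -> R -> L2 R,
  (forall m, simple_L2 (f_ m)) /\
  forall t, D t -> L2norm (f_ m t - f t) @[m --> \oo] --> 0.

(* membership in the Bochner space L_1(D; L_2(0,1)) *)
Definition bochner_L1 D f := strongly_measurable D f /\
  (\int[lebesgue_measure]_(t in (D : set (measurableTypeR R)))
     (L2norm (f t))%:E < +oo)%E.

Definition C1c a b (phi : R -> R) :=
  [/\ forall t, derivable phi t 1, continuous (derive1 phi),
      compact (closure [set t | phi t != 0]) &
      closure [set t | phi t != 0] `<=` [set` `]a, b[]].

(* The identity \int phi' g = - \int phi f between Bochner integrals, tested
   against every h in L_2(0,1). *)
Definition weak_derivative a b g f := forall (phi : R -> R) (h : L2 R),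
  C1c a b phi ->
  \int[lebesgue_measure]_(t in `]a, b[) (derive1 phi t * L2dot (g t) h) =
  - \int[lebesgue_measure]_(t in `]a, b[) (phi t * L2dot (f t) h).

(* W^1_1((0,T]; L_2(0,1)): as usual for the half-open interval, the weak
   derivative on (0,T) is only required to be integrable away from 0. *)
Definition W11 T g := bochner_L1 `]0, T[ g /\
  exists f, (forall d, 0 < d < T -> bochner_L1 `]d, T[ f) /\
            weak_derivative 0 T g f.

Definition continuous_L2 g := forall t, 0 <= t ->
  L2norm (g r - g t) @[r --> within [set r | 0 <= r] (nbhs t)] --> 0.

Definition is_strong_derive g t (v : L2 R) :=
  L2norm (h^-1 *: (g (t + h) - g t) - v) @[h --> 0^'] --> 0.

(* Only the restriction of g to [0, +oo[ matters. *)
Definition strong_solution (F : L2 R -> R) (g0 : R -> R) g :=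
  [/\ forall T, 0 < T -> W11 T g,
      continuous_L2 g,
      {ae leb01, forall s, g 0 s = g0 s} &
      {ae (@lebesgue_measure R), forall t, 0 < t ->
        exists2 v, is_strong_derive g t v & subdiff F (g t) (- v)}].

End vector_valued.

Section quantile.
Context {R : realType}.
Implicit Types mu nu : probability (measurableTypeR R) R.

Definition finite_second_moment mu := (\int[mu]_x (x ^+ 2)%:E < +oo)%E.

Definition Rplus mu (x : R) : R := fine (mu [set` `]-oo, x]]).

(* The minimum exists for 0 < s < 1; the default 0 is used for other s. *)
Definition quantile mu (s : R) : R :=
  let A := [set x | s <= Rplus mu x] in xget 0 [set x | A x /\ lbound A x].

Definition Fnu nu (u : L2 R) : R :=
  \int[leb01]_s ((1 - 2 * s) * u s + \int[leb01]_t `|u s - quantile nu t|).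

End quantile.

Section explicit_flow.
Context {R : realType}.
(* The points x_1 < ... < x_n and weights w_1, ..., w_n are indexed from 1. *)
Variables (n : nat) (x w : nat -> R).

Definition cumw (k : nat) : R := \sum_(1 <= j < k.+1) w j.

(* x_0 = -oo, x_(n+1) = +oo *)
Definition xbar (j : nat) : \bar R :=
  if j == 0%N then -oo%E else if (j <= n)%N then (x j)%:E else +oo%E.

Definition ell (s : R) : nat :=
  xget 0%N [set l | (1 <= l <= n)%N /\ cumw l.-1 < s < cumw l].

(* Below, q0 and q1 stand for the values at s of the quantile functions of
   mu_0 and nu.  When q0 = q1, both cases give the index ell s and no
   breakpoint is used. *)
Variables (q0 q1 s : R).

Definition kidx : nat :=
  if q0 <= q1
  then xget 0%N [set k | (k <= n)%N /\ (xbar k <= q0%:E < xbar k.+1)%E]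
  else xget 0%N [set k | (1 <= k <= n.+1)%N /\ (xbar k.-1 < q0%:E <= xbar k)%E].

Definition nsteps : nat := `|(ell s)%:Z - kidx%:Z|%N.

Definition xstep (j : nat) : R :=
  if q0 <= q1 then x (kidx + j)%N else x (kidx - j)%N.

Definition Rstep (j : nat) : R :=
  if q0 <= q1 then cumw (kidx + j)%N else cumw (kidx - j - 1)%N.

Fixpoint tstep (j : nat) : R :=
  match j with
  | 0 => 0
  | 1 => (xstep 1 - q0) / (2 * (s - Rstep 0))
  | (_.+1 as j').+1 =>
      tstep j' + (xstep j'.+1 - xstep j') / (2 * (s - Rstep j'))
  end.

Definition explicit_trajectory (y : R -> R) :=
  [/\ (0 < nsteps)%N -> forall t, tstep 0 <= t < tstep 1 ->
        y t = q0 + 2 * (s - Rstep 0) * t,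
      forall j, (1 <= j < nsteps)%N -> forall t, tstep j <= t < tstep j.+1 ->
        y t = xstep j + 2 * (s - Rstep j) * (t - tstep j) &
      forall t, tstep nsteps <= t -> y t = q1].

End explicit_flow.

(* Main.v *)
Require Import Defs.
From HB Require Import structures.
From mathcomp Require Import all_boot all_order all_algebra.
From mathcomp Require Import all_classical all_reals all_analysis.
From mathcomp Require Import measurable_realfun zify ring lra.

(** The functional decouples over the parameter [s].  Since the quantile function
    of [nu] transports Lebesgue measure on (0,1) to [nu], [Fnu nu u] is the
    integral over [s] of [potential s (u s)], where [potential s] is the convex
    piecewise linear function [y |-> (1 - 2 s) y + \sum_j w_j |y - x_j|].  On the
    gap between [x_k] and [x_(k+1)] its slope is [2 (W_k - s)], and its minimum
    is attained at [x_(ell s) = quantile nu s].  The gradient flow is therefore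
    a family of independent one-dimensional steepest descents: the particle
    [s] starts at [quantile mu0 s] and crosses the gap [k] with the constant
    velocity [2 (s - W_k)], always towards [x_(ell s)], where it stops.  The
    explicit formula of the theorem is the description of this polygonal motion.

    That these motions form a strong solution ([flow_strong_solution]) has a
    pointwise part and a functional analytic part.  Pointwise, minus the velocity
    is a subgradient of [potential s] at the position ([motion_subgrad]), and
    this integrates to a subgradient of [Fnu nu] ([subdiff_Fnu]).  In
    L_2(0,1), all velocities are bounded by 2, so the flow is Lipschitz.  Its
    strong derivative at time [t] exists as soon as almost no particle changes
    its velocity exactly at [t]; by Fubini's theorem this is the case for
    almost every [t] ([flow_strong_derive]).  Velocities are right continuous
    in time, which gives strong measurability, and an almost everywhere strong
    derivative of a Lipschitz curve is its weak derivative
    ([lipschitz_weak_derivative]).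

    Uniqueness ([strong_solution_unique]) is the contraction argument: along two
    solutions [g1], [g2] of a convex problem the squared distance has
    nonpositive derivative almost everywhere, by monotonicity of the
    subdifferential.  To integrate this differential inequality one needs that the
    squared distance is absolutely continuous; testing the definition of the weak
    derivative against trapezoids bounds the increments of [g1] and [g2] by
    integrals ([weak_derivative_increment]).  The integration itself is
    [dini_noninc]: a function whose increments are dominated by the integrals of
    an integrable function, and whose upper right derivative is nonpositive
    almost everywhere, does not increase.  The same criterion shows that
    Lipschitz functions can be integrated by parts ([lipschitz_by_parts]). *)

Set Implicit Arguments.
Unset Strict Implicit.
Unset Printing Implicit Defensive.

Import Order.TTheory GRing.Theory Num.Theory.
Import numFieldNormedType.Exports.

Local Open Scope classical_set_scope.
Local Open Scope ring_scope.

(** * The Hilbert space L_2(0,1) *)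

Section real_integrable.
Context d (T : measurableType d) {R : realType}.
Variables (m : {measure set T -> \bar R}) (D : set T).
Hypothesis mD : measurable D.
Implicit Types f g : T -> R.

Lemma EFin_integrableD f g :
  m.-integrable D (EFin \o f) -> m.-integrable D (EFin \o g) ->
  m.-integrable D (EFin \o (fun s => f s + g s)).
Proof. by move=> mf mg; exact: (integrableD mD mf mg). Qed.

Lemma EFin_integrableB f g :
  m.-integrable D (EFin \o f) -> m.-integrable D (EFin \o g) ->
  m.-integrable D (EFin \o (fun s => f s - g s)).
Proof. by move=> mf mg; exact: (integrableB mD mf mg). Qed.

Lemma EFin_integrableZl (a : R) f : m.-integrable D (EFin \o f) ->
  m.-integrable D (EFin \o (fun s => a * f s)).
Proof. by move=> mf; exact: (integrableZl mD a mf). Qed.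

Lemma EFin_integrable_sum (k : nat) (F : 'I_k -> T -> R) :
  (forall j, m.-integrable D (EFin \o F j)) ->
  m.-integrable D (EFin \o (fun s => \sum_(j < k) F j s)).
Proof.
move=> iF; have := integrable_sum mD (index_enum 'I_k) (fun j _ => iF j) (P := xpredT).
by apply: eq_integrable => // s _; rewrite /= sumEFin.
Qed.

End real_integrable.

Section L2_facts.
Context {R : realType}.
Implicit Types (u v z : L2 R) (a : R).

Lemma leb01E (A : set R) : measurable A ->
  leb01 A = lebesgue_measure (A `&` `]0%R, 1%R[).
Proof. by []. Qed.

Lemma leb01T : leb01 [set: R] = 1%E.
Proof.
by rewrite /leb01 /= /mrestr setTI lebesgue_measure_itv/= lte_fin ltr01 oppr0 adde0.
Qed.

Lemma leb01_fin (A : set R) : measurable A -> (leb01 A < +oo)%E.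
Proof.
move=> mA; apply: (@le_lt_trans _ _ (leb01 [set: R])); last by rewrite leb01T ltry.
by apply: le_measure => //; rewrite inE.
Qed.

Lemma measurable_L2 u : measurable_fun setT u.
Proof. exact: measurable_funPT. Qed.

Lemma L2_integrableM u v : leb01.-integrable setT (EFin \o (fun s => u s * v s)).
Proof. exact/Lfun1_integrable/(Lfun2_mul_Lfun1 (LfunP u) (LfunP v)). Qed.

Lemma L2_integrable u : leb01.-integrable setT (EFin \o u).
Proof.
apply/Lfun1_integrable/Lfun_subset12; last exact: LfunP.
by rewrite ge0_fin_numE// leb01_fin.
Qed.

Lemma L2dotC u v : L2dot u v = L2dot v u.
Proof. by apply: eq_Rintegral => s _; rewrite mulrC. Qed.

Lemma L2dotDl u v z : L2dot (u + v) z = L2dot u z + L2dot v z.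
Proof.
rewrite /L2dot -RintegralD//; try exact: L2_integrableM.
by apply: eq_Rintegral => s _; rewrite -mulrDl.
Qed.

Lemma L2dotZl a u z : L2dot (a *: u) z = a * L2dot u z.
Proof.
rewrite /L2dot -RintegralZl//; try exact: L2_integrableM.
by apply: eq_Rintegral => s _; rewrite mulrA.
Qed.

Lemma L2dotNl u z : L2dot (- u) z = - L2dot u z.
Proof. by rewrite -scaleN1r L2dotZl mulN1r. Qed.

Lemma L2dotBl u v z : L2dot (u - v) z = L2dot u z - L2dot v z.
Proof. by rewrite L2dotDl L2dotNl. Qed.

Lemma L2dotDr u v z : L2dot z (u + v) = L2dot z u + L2dot z v.
Proof. by rewrite L2dotC L2dotDl !(L2dotC z). Qed.

Lemma L2dotZr a u z : L2dot z (a *: u) = a * L2dot z u.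
Proof. by rewrite L2dotC L2dotZl (L2dotC z). Qed.

Lemma L2dotBr u v z : L2dot z (u - v) = L2dot z u - L2dot z v.
Proof. by rewrite L2dotC L2dotBl !(L2dotC z). Qed.

Lemma L2dot_ge0 u : 0 <= L2dot u u.
Proof. by apply: Rintegral_ge0 => s _; rewrite -expr2 sqr_ge0. Qed.

Lemma L2normE u : L2norm u = Num.sqrt (L2dot u u).
Proof.
rewrite /L2norm unlock /L2dot /Rintegral.
have -> : (\int[leb01]_x (`|(EFin \o u) x| `^ 2) = \int[leb01]_x (u x * u x)%:E)%E.
  apply: eq_integral => s _ /=.
  by rewrite -expr2 powR_mulrn// real_normK// num_real.
rewrite fine_poweR -powR12_sqrt// fine_ge0//.
by apply: integral_ge0 => s _; rewrite lee_fin -expr2 sqr_ge0.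
Qed.

Lemma L2norm_ge0 u : 0 <= L2norm u.
Proof. by rewrite L2normE sqrtr_ge0. Qed.

Lemma L2norm_sqr u : L2norm u ^+ 2 = L2dot u u.
Proof. by rewrite L2normE sqr_sqrtr// L2dot_ge0. Qed.

Lemma L2normZ a u : L2norm (a *: u) = `|a| * L2norm u.
Proof.
by rewrite !L2normE L2dotZl L2dotZr mulrA -expr2 sqrtrM ?sqr_ge0// sqrtr_sqr.
Qed.

Lemma L2normN u : L2norm (- u) = L2norm u.
Proof. by rewrite -scaleN1r L2normZ normrN1 mul1r. Qed.

Lemma L2norm0 : L2norm (0 : L2 R) = 0.
Proof. by rewrite -(scale0r (0 : L2 R)) L2normZ normr0 mul0r. Qed.

Lemma L2normB u v : L2norm (u - v) = L2norm (v - u).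
Proof. by rewrite -L2normN opprB. Qed.

Lemma ler_L2normD u v : L2norm (u + v) <= L2norm u + L2norm v.
Proof. exact: ler_LnormD. Qed.

(** Cauchy-Schwarz, read off from Minkowski's inequality by expanding the square
    of the norm of [u + v]. *)
Lemma L2dot_le u v : L2dot u v <= L2norm u * L2norm v.
Proof.
have := L2norm_sqr (u + v); rewrite L2dotDl !L2dotDr -!L2norm_sqr (L2dotC v u).
have : L2norm (u + v) ^+ 2 <= (L2norm u + L2norm v) ^+ 2.
  by rewrite ler_sqr ?nnegrE ?addr_ge0 ?L2norm_ge0// ler_L2normD.
by rewrite sqrrD; lra.
Qed.

Lemma L2dot_norm u v : `|L2dot u v| <= L2norm u * L2norm v.
Proof.
rewrite ler_norml L2dot_le andbT lerNl -L2dotNl -(L2normN u).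
exact: L2dot_le.
Qed.

Lemma ler_L2normB u v : `|L2norm u - L2norm v| <= L2norm (u - v).
Proof.
have h (a b : L2 R) : L2norm a <= L2norm b + L2norm (a - b).
  by rewrite (le_trans _ (ler_L2normD _ _))// addrC subrK.
by have := h u v; have := h v u; rewrite (L2normB v u) ler_norml; lra.
Qed.

(** The form in which the Cauchy-Schwarz inequality passes from norm convergence
    to convergence of scalar products. *)
Lemma L2dot_small z e : 0 < e -> exists2 d, 0 < d &
  forall u, L2norm u <= d -> `|L2dot u z| <= e.
Proof.
move=> e0; have z1 : 0 < L2norm z + 1 by rewrite ltr_wpDl// L2norm_ge0.
exists (e / (L2norm z + 1)) => [|u ud]; first exact: divr_gt0.
apply: le_trans (L2dot_norm _ _) _.
apply: (@le_trans _ _ (e / (L2norm z + 1) * (L2norm z + 1))).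
  by apply: ler_pM => //; rewrite ?L2norm_ge0// lerDl.
by rewrite divfK// gt_eqF.
Qed.
Lemma L2norm_eq0 u : L2norm u = 0 -> {ae leb01, forall s, u s = 0}.
Proof.
move=> u0; have := fine_Lnormr_eq0 u0.
by apply: filterS => s /=; apply.
Qed.

Lemma ae0_L2norm u : {ae leb01, forall s, u s = 0} -> L2norm u = 0.
Proof.
move=> u0; rewrite L2normE (_ : L2dot u u = 0) ?sqrtr0// /L2dot /Rintegral.
rewrite (ae_eq_integral (cst 0%E)) ?integral0//.
  by apply/measurable_EFinP; apply: measurable_funM; exact: measurable_L2.
by apply: filterS u0 => s us0 _; rewrite us0 mul0r.
Qed.

Lemma L2_mem (f : R -> R) :
  measurable_fun [set: measurableTypeR R] f ->
  (\int[leb01]_s (f s ^+ 2)%:E < +oo)%E -> f \in Lfun leb01 2%:E.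
Proof.
move=> mf f2; rewrite inE; apply/andP; split; rewrite inE//=.
rewrite /finite_norm unlock poweR_lty//.
under eq_integral => s _.
  rewrite (_ : (`|(EFin \o f) s| `^ 2)%E = (f s ^+ 2)%:E); last first.
    by rewrite /= powR_mulrn// real_normK// num_real.
  over.
exact: f2.
Qed.

Lemma ae_leb01 : {ae leb01, forall s : R, 0 < s < 1}.
Proof.
exists (~` `]0%R, 1%R[%classic); split.
- exact: measurableC.
- by rewrite leb01E ?setICl ?measure0//; exact: measurableC.
- by move=> s /=; rewrite in_itv.
Qed.

Lemma leb01_integrable_cst a : leb01.-integrable setT (EFin \o cst a).
Proof.
apply/integrableP; split; first exact/measurable_EFinP/measurable_cst.
under eq_integral do rewrite /=.
by rewrite integral_cst// leb01T mule1 ltry.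
Qed.

Lemma ae_le_Rintegral (f1 f2 : R -> R) :
  leb01.-integrable setT (EFin \o f1) -> leb01.-integrable setT (EFin \o f2) ->
  {ae leb01, forall s, f1 s <= f2 s} ->
  \int[leb01]_s f1 s <= \int[leb01]_s f2 s.
Proof.
move=> i1 i2 f12.
rewrite -subr_ge0 -RintegralB// /Rintegral.
have -> : (\int[leb01]_s (f2 s - f1 s)%:E = \int[leb01]_s `|f2 s - f1 s|%:E)%E.
  have /measurable_EFinP m1 : measurable_fun setT (EFin \o f1).
    exact: (measurable_int leb01).
  have /measurable_EFinP m2 : measurable_fun setT (EFin \o f2).
    exact: (measurable_int leb01).
  apply: ae_eq_integral => //.
  - by apply/measurable_EFinP; exact: measurable_funB.
  - apply/measurable_EFinP; apply: measurableT_comp => //.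
    exact: measurable_funB.
  - move: f12; apply: filterS; first exact: (ae_filter_ringOfSetsType leb01).
    by move=> s h _ /=; rewrite ger0_norm// subr_ge0.
by rewrite fine_ge0// integral_ge0.
Qed.

Lemma id_L2 : (fun s : R => s) \in Lfun leb01 2%:E.
Proof.
apply: L2_mem => //; apply: (@le_lt_trans _ _ (\int[leb01]_s (cst 1 s))%E).
  apply: ae_ge0_le_integral => //.
  - by move=> s _; rewrite lee_fin sqr_ge0.
  - by apply/measurable_EFinP; exact: measurable_funX.
  - move: ae_leb01; apply: filterS; first exact: (ae_filter_ringOfSetsType leb01).
    by move=> s /andP[s0 s1] _; rewrite lee_fin expr_le1// ltW.
by rewrite integral_cst// leb01T mule1 ltry.
Qed.

Definition L2_id : L2 R := Lfun_Sub (lee1n 2) id_L2.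

Lemma L2_addE u v s : (u + v) s = u s + v s. Proof. by []. Qed.
Lemma L2_oppE u s : (- u) s = - u s. Proof. by []. Qed.
Lemma L2_scaleE a u s : (a *: u) s = a * u s. Proof. by []. Qed.
Definition L2E := (L2_addE, L2_oppE, L2_scaleE).

End L2_facts.

(** * A monotonicity criterion for absolutely continuous functions *)

Section dini.
Context {R : realType}.
Notation mu := (@lebesgue_measure R).
Implicit Types (a b c s t e : R) (m phi : R -> R).

(** Outer regularity, combined with absolute continuity of the integral: an
    exceptional null set is hidden in an open set on which the dominating
    function contributes almost nothing. *)
Lemma null_cover_small_integral (N : set R) m e : mu.-negligible N ->
  mu.-integrable setT (EFin \o m) -> 0 < e ->
  exists U : set R, [/\ open U, N `<=` U & \int[mu]_(x in U) `|m x| < e].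
Proof.
move=> [A [mA A0 NA]] im e0.
have [d [d0 md]] := integral_normr_continuous im e0.
have Afin : (mu A < +oo)%E by rewrite [X in (X < _)%E]A0.
have [U [oU AU Ud]] := lebesgue_regularity_outer mA Afin d0.
exists U; split => //; first exact: subset_trans AU.
have mU : measurable (U : set (measurableTypeR R)) by exact: open_measurable.
apply: md => //; apply: le_lt_trans Ud.
rewrite -[X in (mu X <= _)%E](setDUK AU) setUC.
apply: (le_trans (measureU2 _ _ _)) => //; first exact: measurableD.
by rewrite [X in (_ + X)%E]A0 adde0.
Qed.

Lemma small_integral_left c m e : mu.-integrable setT (EFin \o m) -> 0 < e ->
  exists2 d, 0 < d & forall t, c - d < t -> \int[mu]_(x in `[t, c]) `|m x| < e.
Proof.
move=> im e0; have [d [d0 md]] := integral_normr_continuous im e0.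
exists d => // t ct; apply: md => //.
by rewrite /= lebesgue_measure_itv/= lte_fin; case: ifPn => // _; rewrite lte_fin; lra.
Qed.

(** With [U] an open set of small [m]-integral around the exceptional null set,
    the barrier [K t = phi a + ee (t - a) + \int_(U `&` [a, t]) m] is shown to stay
    above [phi] by continuous induction.  From the last time [c] at which this is
    known one can always proceed: if [c] is in [U] then [m] pays for the
    increment of [phi] on a neighbourhood of [c], and otherwise the Dini
    condition holds at [c] and the linear term pays. *)
Lemma dini_noninc a b phi m : a <= b ->
  mu.-integrable `[a, b] (EFin \o m) -> (forall t, 0 <= m t) ->
  (forall s t, a <= s -> s <= t -> t <= b ->
    phi t - phi s <= \int[mu]_(r in `[s, t]) m r) ->
  {ae mu, forall t, a < t < b ->
    forall e, 0 < e -> \forall h \near 0^'+, phi (t + h) <= phi t + e * h} ->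
  phi b <= phi a.
Proof.
move=> ab im m0 phim [N0 [mN0 N00 hN0]].
pose m' := m \_ `[a, b].
have m'0 t : 0 <= m' t by rewrite /m' patchE; case: ifP.
have im' : mu.-integrable setT (EFin \o m').
  by rewrite -restrict_EFin; apply/(integrable_mkcond _ _).1.
have phim' s t : a <= s -> s <= t -> t <= b ->
    phi t - phi s <= \int[mu]_(r in `[s, t]) m' r.
  move=> as_ st tb; apply: (le_trans (phim _ _ as_ st tb)).
  rewrite le_eqVlt; apply/orP; left; apply/eqP/eq_Rintegral => r.
  rewrite inE/= in_itv/= => /andP[sr rt].
  by rewrite /m' patchE mem_set//= in_itv/= (le_trans as_)//= (le_trans rt).
have iS (A : set R) : measurable (A : set (measurableTypeR R)) ->
    mu.-integrable A (EFin \o m').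
  by move=> mA; exact: integrableS im'.
apply/ler_addgt0Pr => e e0.
have e1 : 0 < e / (b - a + 1) by apply: divr_gt0 => //; lra.
set ee := e / (b - a + 1) in e1.
(* The end point [a] is added since the Dini condition is only known inside. *)
have negN : mu.-negligible (N0 `|` [set a]).
  apply: negligibleU; first by apply/negligibleP.
  by apply/negligibleP => //; exact: lebesgue_measure_set1.
have [U [oU NU Ue]] := null_cover_small_integral negN im' e1.
have mU : measurable (U : set (measurableTypeR R)) by exact: open_measurable.
pose M t := \int[mu]_(r in U `&` `[a, t]) m' r.
have MD s t : a <= s -> s <= t -> M t = M s + \int[mu]_(r in U `&` `]s, t]) m' r.
  move=> as_ st; rewrite /M -Rintegral_setU//=.
  - congr Rintegral; rewrite -setIUr; congr setI.
    by rewrite -itv_bndbnd_setU// bnd_simp.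
  - exact: measurableI.
  - exact: measurableI.
  - by apply: iS; apply: measurableU; exact: measurableI.
  - rewrite disj_set2E; apply/eqP; rewrite -subset0 => r /= [[_]].
    by rewrite !in_itv/= => /andP[_ rs] [_] /andP[sr _]; lra.
have Mle s t : a <= s -> s <= t -> M s <= M t.
  by move=> as_ st; rewrite (MD s t)// lerDl Rintegral_ge0.
have MU s t : a <= s -> s <= t -> (forall r, s <= r -> r <= t -> U r) ->
    M t = M s + \int[mu]_(r in `[s, t]) m' r.
  move=> as_ st sU; rewrite (MD s t)//; congr (_ + _).
  have -> : U `&` `]s, t] = `]s, t]%classic.
    apply/setIidr => r /=; rewrite in_itv/= => /andP[sr rt].
    by apply: sU => //; exact: ltW.
  by apply: Rintegral_itv_obnd_cbnd; exact: iS.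
pose K t := phi a + ee * (t - a) + M t.
have Kle s t : a <= s -> s <= t -> K s <= K t.
  move=> as_ st; rewrite /K lerD ?Mle// lerD2l ler_pM2l//; lra.
(* The supremum of [S] belongs to [S]: upward jumps of [phi] are excluded,
   because its increments are dominated by an integral. *)
pose S := [set t | a <= t <= b /\ phi t <= K t].
have Sa : S a.
  split; first by rewrite lexx.
  by rewrite /K subrr mulr0 addr0 lerDl Rintegral_ge0.
have hS : has_sup S.
  by split; [exists a | exists b => t [/andP[]]].
have leS t : S t -> t <= sup S by apply: sup_upper_bound.
have ac : a <= sup S by exact: leS.
have cb : sup S <= b by apply: sup_le_ub; [exists a | move=> t [/andP[]]].
set c := sup S in leS ac cb *.
have Sc : phi c <= K c.
  apply/ler_addgt0Pr => h h0.
  have [d d0 hd] := small_integral_left c im' h0.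
  have [t [/andP[at_ tb] phit] ct] := sup_adherent d0 hS.
  have tc : t <= c by apply: leS; split=> //; rewrite at_.
  have := phim' t c at_ tc cb; have := hd t ct.
  under eq_Rintegral do rewrite ger0_norm//.
  by have := Kle t c at_ tc; lra.
have Kb : K b <= phi a + e.
  rewrite /K -addrA lerD2l.
  have -> : e = ee * (b - a) + ee.
    by rewrite -[X in _ + X]mulr1 -mulrDr /ee divfK// gt_eqF//; lra.
  rewrite lerD2l; apply: le_trans (ltW Ue).
  under [leRHS]eq_Rintegral do rewrite ger0_norm//.
  have mUab : measurable (U `&` `[a, b] : set (measurableTypeR R)).
    exact: measurableI.
  rewrite /M /Rintegral fine_le//.
  - by apply: integrable_fin_num; [|exact: iS].
  - by apply: integrable_fin_num; [|exact: iS].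
  - apply: ge0_subset_integral => //.
    + by apply: (measurable_int mu); exact: iS.
    + by move=> r _; rewrite lee_fin.
move: cb; rewrite le_eqVlt => /predU1P[cb|cb].
  by rewrite -cb in Kb *; exact: le_trans Sc Kb.
exfalso.
suff [h [h0 cbh]] : exists h, [/\ 0 < h, c + h <= b & phi (c + h) <= K (c + h)].
  move=> hK; have : c + h <= c.
    apply: leS; split => //.
    by rewrite cbh andbT; lra.
  by rewrite gerDl leNgt h0.
(* [c < b] is contradictory because the barrier survives a little beyond. *)
have [Uc|nUc] := pselect (U c).
  have /nbhs_ballP[d /= d0 dU] : nbhs c U by exact: open_nbhs_nbhs.
  pose h := Num.min (d / 2) (b - c).
  have h0 : 0 < h by rewrite lt_min; apply/andP; split; lra.
  have hd : h < d by rewrite /h gt_min; apply/orP; left; lra.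
  have hb : h <= b - c by rewrite /h ge_min lexx orbT.
  exists h; split => //; first lra.
  have cch : c <= c + h by lra.
  have := phim' c (c + h) ac cch; rewrite /K (MU c (c + h))//; last first.
    move=> r cr rch; apply: dU; rewrite /ball/= ler0_norm; lra.
  have : ee * (c - a) <= ee * (c + h - a) by rewrite ler_pM2l//; lra.
  by move: Sc; rewrite /K => Sc ? /(_ _); lra.
have cNa : c != a by apply/eqP => ca; apply: nUc; apply: NU; right; rewrite ca.
have ac' : a < c by rewrite lt_neqAle eq_sym cNa.
have : forall e, 0 < e -> \forall h \near 0^'+, phi (c + h) <= phi c + e * h.
  apply: contrapT => nh; apply: nUc; apply: NU; left; apply: hN0 => /= /(_ _).
  by rewrite ac' cb => /(_ isT).
move=> /(_ _ e1) hc.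
have : \forall h \near 0^'+, [/\ 0 < h, h < b - c & phi (c + h) <= phi c + ee * h].
  near=> h; split => //; near: h => //.
  by apply: nbhs_right_lt; lra.
move=> /filter_ex[h [h0 hb hphi]].
exists h; split => //; first lra.
have := Mle c (c + h) ac; rewrite /K; move: Sc; rewrite /K => Sc.
have -> : ee * (c + h - a) = ee * (c - a) + ee * h by ring.
by move=> /(_ _); lra.
Unshelve. all: by end_near. Qed.

End dini.

(** * Smooth steps *)

Section smooth_step.
Context {R : realType}.
Notation mu := (@lebesgue_measure R).
Implicit Types (c d e r s t x : R).

Lemma is_derive_quadratic (f : R -> R) x df C :
  (forall h, `|f (x + h) - f x - df * h| <= C * h ^+ 2) -> is_derive x 1 f df.
Proof.
move=> fC.
have H : h^-1 *: (f (h *: 1 + x) - f x) @[h --> 0^'] --> df.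
  apply/cvgrPdist_lep; near=> e.
  near=> h.
  have h0 : h != 0 by near: h; exact: nbhs_dnbhs_neq.
  rewrite distrC /GRing.scale /= mulr1 (addrC h).
  have -> : h^-1 * (f (x + h) - f x) - df = h^-1 * (f (x + h) - f x - df * h) by field.
  rewrite normrM normfV ler_pdivrMl ?normr_gt0//; apply: le_trans (fC h) _.
  rewrite -(real_normK (num_real h)) expr2 mulrCA ler_pM2l ?normr_gt0//.
  have e0 : 0 < e by near: e; exact: nbhs_right_gt.
  have C0 : C <= `|C| + 1 by rewrite (le_trans (ler_norm _))// lerDl.
  apply: (@le_trans _ _ ((`|C| + 1) * `|h|)); first by rewrite ler_wpM2r.
  rewrite -ler_pdivlMl ?ltr_wpDl//; near: h; apply: dnbhs0_le.
  by rewrite mulr_gt0// invr_gt0 ltr_wpDl.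
split; first by apply/cvg_ex; exists df.
exact: cvg_lim H.
Unshelve. all: by end_near. Qed.

(** A C^1 step from 0 at [c] to 1 at [c + 2 d], the primitive of a tent of mass
    1.  Both are second differences of truncated powers, which reduces
    differentiation to that of [fun r => Num.max r 0 ^+ 2]. *)
Definition step d c r : R :=
  (Num.max (r - c) 0 ^+ 2 - 2 * Num.max (r - c - d) 0 ^+ 2
   + Num.max (r - c - 2 * d) 0 ^+ 2) / (2 * d ^+ 2).

Definition tent d c r : R :=
  (Num.max (r - c) 0 - 2 * Num.max (r - c - d) 0
   + Num.max (r - c - 2 * d) 0) / d ^+ 2.

Lemma pos_sqr_quadratic x h :
  `|Num.max (x + h) 0 ^+ 2 - Num.max x 0 ^+ 2 - 2 * Num.max x 0 * h| <= h ^+ 2.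
Proof.
rewrite ler_norml.
by case: (leP (x + h) 0); case: (leP x 0) => ? ?; apply/andP; split; nra.
Qed.

Lemma is_derive_step d c r : 0 < d -> is_derive r 1 (step d c) (tent d c r).
Proof.
move=> d0; apply: (@is_derive_quadratic _ _ _ (2 / d ^+ 2)) => h.
have h1 := pos_sqr_quadratic (r - c) h.
have h2 := pos_sqr_quadratic (r - c - d) h.
have h3 := pos_sqr_quadratic (r - c - 2 * d) h.
have d2 : 0 < (2 * d ^+ 2)^-1 by rewrite invr_gt0 mulr_gt0// exprn_gt0.
have -> : step d c (r + h) - step d c r - tent d c r * h =
  ((Num.max (r - c + h) 0 ^+ 2 - Num.max (r - c) 0 ^+ 2
      - 2 * Num.max (r - c) 0 * h)
   - 2 * (Num.max (r - c - d + h) 0 ^+ 2 - Num.max (r - c - d) 0 ^+ 2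
      - 2 * Num.max (r - c - d) 0 * h)
   + (Num.max (r - c - 2 * d + h) 0 ^+ 2 - Num.max (r - c - 2 * d) 0 ^+ 2
      - 2 * Num.max (r - c - 2 * d) 0 * h)) * (2 * d ^+ 2)^-1.
  rewrite /step /tent.
  have -> : r + h - c = r - c + h by ring.
  have -> : r - c + h - d = r - c - d + h by ring.
  have -> : r - c + h - 2 * d = r - c - 2 * d + h by ring.
  by field; rewrite gt_eqF.
have -> : 2 / d ^+ 2 * h ^+ 2 = 4 * h ^+ 2 * (2 * d ^+ 2)^-1.
  by field; rewrite gt_eqF.
rewrite normrM (gtr0_norm d2) ler_pM2r//.
by move: h1 h2 h3; rewrite !ler_norml; lra.
Qed.

Lemma tent_ge0 d c r : 0 < d -> 0 <= tent d c r.
Proof.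
move=> d0; rewrite /tent divr_ge0 ?exprn_ge0 ?(ltW d0)//.
by case: (leP (r - c) 0); case: (leP (r - c - d) 0);
  case: (leP (r - c - 2 * d) 0) => ? ? ?; lra.
Qed.

Lemma tent_out d c r : 0 < d -> ~ (c <= r <= c + 2 * d) -> tent d c r = 0.
Proof.
move=> d0 rc.
have [rlec|cr] := leP r c.
  by rewrite /tent !max_r; lra.
have rcd : c + 2 * d <= r.
  by rewrite leNgt; apply/negP => rc'; apply: rc; rewrite !ltW.
by rewrite /tent !max_l; lra.
Qed.

Lemma step_left d c r : 0 < d -> r <= c -> step d c r = 0.
Proof.
move=> d0 rc; by rewrite /step !max_r ?expr0n/=; lra.
Qed.

Lemma step_right d c r : 0 < d -> c + 2 * d <= r -> step d c r = 1.
Proof.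
move=> d0 rc; rewrite /step !max_l; try lra.
by field; rewrite gt_eqF.
Qed.

Lemma step01 d c r : 0 < d -> 0 <= step d c r <= 1.
Proof.
move=> d0; have d2 : 0 < 2 * d ^+ 2 by rewrite mulr_gt0// exprn_gt0.
rewrite /step; apply/andP; split.
  apply: divr_ge0; last exact: ltW.
  by case: (leP (r - c) 0); case: (leP (r - c - d) 0);
    case: (leP (r - c - 2 * d) 0) => ? ? ?; nra.
rewrite ler_pdivrMr// mul1r.
by case: (leP (r - c) 0); case: (leP (r - c - d) 0);
  case: (leP (r - c - 2 * d) 0) => ? ? ?; nra.
Qed.

Lemma continuous_tent d c : continuous (tent d c).
Proof.
have q (k : R) : continuous (fun r : R => Num.max (r - k) 0).
  move=> r; apply: (@continuous_max _ _ (fun r => r - k) (fun=> 0)).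
    by apply: cvgB; [exact: cvg_id | exact: cvg_cst].
  exact: cvg_cst.
move=> r; rewrite /tent; apply: cvgMl; apply: cvgD; [apply: cvgB; [|apply: cvgMr]|].
- exact: q.
- by under eq_fun do rewrite -addrA -opprD; rewrite -addrA -opprD; exact: q.
- by under eq_fun do rewrite -addrA -opprD; rewrite -addrA -opprD; exact: q.
Qed.

Lemma tent_integral d c T : 0 < d -> 0 <= c -> c + 2 * d <= T ->
  \int[mu]_(r in `]0, T[) tent d c r = 1.
Proof.
move=> d0 c0 cT; have T0 : 0 < T by lra.
have mt : measurable_fun `]0, T[ (EFin \o tent d c).
  apply/measurable_EFinP; apply: measurable_funTS.
  by apply: continuous_measurable_fun; exact: continuous_tent.
rewrite /Rintegral -(@integral_itv_bndoo _ _ _ _ true false mt).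
rewrite (@continuous_FTC2 _ _ (step d c))//.
- by rewrite step_right// step_left// -EFinB subr0.
- by apply: continuous_subspaceT; exact: continuous_tent.
- have cs : continuous (step d c).
    move=> r; apply: differentiable_continuous; apply/derivable1_diffP.
    by have [] := is_derive_step c r d0.
  split => //.
  + by move=> r _; have [] := is_derive_step c r d0.
  + by apply: cvg_at_right_filter; exact: cs.
  + by apply: cvg_at_left_filter; exact: cs.
- by move=> r _; rewrite derive1E; have [] := is_derive_step c r d0.
Qed.

(** A tent is an approximate identity: its base, of length [2 d], shrinks to a
    point while its mass stays 1. *)
Lemma tent_mean d c T (p : R -> R) y e : 0 < d -> 0 <= c -> c + 2 * d <= T ->
  {within `[0, T], continuous p} ->
  (forall r, c <= r <= c + 2 * d -> `|p r - y| <= e) ->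
  mu.-integrable `]0, T[ (EFin \o (fun r => tent d c r * p r)) /\
  `|\int[mu]_(r in `]0, T[) (tent d c r * p r) - y| <= e.
Proof.
move=> d0 c0 cT cp pe.
have icc (f : R -> R) : {within `[0, T], continuous f} ->
    mu.-integrable `]0, T[ (EFin \o f).
  move=> cf; apply: (@integrableS _ _ _ mu `[0, T]%classic) => //.
    exact: subset_itv_oo_cc.
  by apply: continuous_compact_integrable => //; exact: segment_compact.
have ct : {within `[0, T], continuous (tent d c)}.
  by apply: continuous_subspaceT; exact: continuous_tent.
have itp : mu.-integrable `]0, T[ (EFin \o (fun r => tent d c r * p r)).
  by apply: icc => r; apply: cvgM; [exact: ct|exact: cp].
split => //.
have it := icc _ ct.
have -> : y = \int[mu]_(r in `]0, T[) (tent d c r * y).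
  by rewrite RintegralZr// tent_integral// mul1r.
have ity : mu.-integrable `]0, T[ (EFin \o (fun r => tent d c r * y)).
  by apply: icc => r; apply: cvgM; [exact: ct|exact: cvg_cst].
rewrite -RintegralB//.
have iB : mu.-integrable `]0, T[ (EFin \o (fun r => tent d c r * p r - tent d c r * y)).
  by apply: icc => r; apply: cvgB; apply: cvgM; [exact: ct|exact: cp|exact: ct|exact: cvg_cst].
apply: le_trans (le_normr_Rintegral _ iB) _ => //.
have -> : e = \int[mu]_(r in `]0, T[) (tent d c r * e).
  by rewrite RintegralZr// tent_integral// mul1r.
apply: le_Rintegral => //.
- exact: integrable_norm.
- by apply: icc => r; apply: cvgM; [exact: ct|exact: cvg_cst].
move=> r _; have [rc|/(tent_out d0) ->] := pselect (c <= r <= c + 2 * d); last first.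
  by rewrite !mul0r subrr normr0.
by rewrite -mulrBr normrM (ger0_norm (tent_ge0 _ _ d0)) ler_wpM2l ?tent_ge0// pe.
Qed.

End smooth_step.

(** * Functions of class W^1_1 with values in L_2(0,1) *)

Section W11_facts.
Context {R : realType}.
Notation mu := (@lebesgue_measure R).
Implicit Types (g f : R -> L2 R) (D : set (measurableTypeR R)) (u v z : L2 R).

Lemma L2dot_suml m (F : 'I_m -> L2 R) z :
  L2dot (\sum_(i < m) F i) z = \sum_(i < m) L2dot (F i) z.
Proof.
apply: (big_morph (fun u => L2dot u z)) => [u v|]; first exact: L2dotDl.
by rewrite -(scale0r (0 : L2 R)) L2dotZl mul0r.
Qed.

Lemma L2dot_sumr m (F : 'I_m -> L2 R) z :
  L2dot z (\sum_(i < m) F i) = \sum_(i < m) L2dot z (F i).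
Proof. by rewrite L2dotC L2dot_suml; apply: eq_bigr => i _; rewrite L2dotC. Qed.

Lemma simple_L2_dot f z : simple_L2 f ->
  measurable_fun [set: measurableTypeR R] (fun t => L2dot (f t) z).
Proof.
move=> [m [A [v [mA fE]]]].
under eq_fun do rewrite fE L2dot_suml.
apply: measurable_sum => i; under eq_fun do rewrite L2dotZl.
by apply: measurable_funM => //; exact: measurable_indic.
Qed.

Lemma simple_L2_norm f : simple_L2 f ->
  measurable_fun [set: measurableTypeR R] (fun t => L2norm (f t)).
Proof.
move=> [m [A [v [mA fE]]]].
under eq_fun do rewrite L2normE.
apply: (@measurableT_comp _ _ _ _ _ _ (@Num.sqrt R)).
  by apply: continuous_measurable_fun; exact: sqrt_continuous.
under eq_fun do rewrite fE L2dot_suml.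
apply: measurable_sum => i; under eq_fun do rewrite L2dot_sumr.
apply: measurable_sum => j; under eq_fun do rewrite L2dotZl L2dotZr.
apply: measurable_funM; first exact: measurable_indic.
by apply: measurable_funM => //; exact: measurable_indic.
Qed.

Lemma strongly_measurable_dot D f z : strongly_measurable D f ->
  measurable_fun D (fun t => L2dot (f t) z).
Proof.
move=> [f_ [sf ff]].
apply: (@measurable_fun_cvg _ _ _ _ (fun m t => L2dot (f_ m t) z)) => [m|t Dt].
  by apply: measurable_funTS; exact: simple_L2_dot.
apply/cvgrPdist_le => e e0; have [d d0 hd] := L2dot_small z e0.
have /cvgrPdist_le/(_ _ d0) := ff t Dt; apply: filterS => m.
rewrite distrC subr0 ger0_norm ?L2norm_ge0// => h.
by rewrite distrC -L2dotBl hd.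
Qed.

Lemma strongly_measurable_norm D f : strongly_measurable D f ->
  measurable_fun D (fun t => L2norm (f t)).
Proof.
move=> [f_ [sf ff]].
apply: (@measurable_fun_cvg _ _ _ _ (fun m t => L2norm (f_ m t))) => [m|t Dt].
  by apply: measurable_funTS; exact: simple_L2_norm.
apply/cvgrPdist_le => e e0.
have /cvgrPdist_le/(_ e e0) := ff t Dt; apply: filterS => m.
rewrite distrC subr0 ger0_norm ?L2norm_ge0// => h.
by rewrite distrC (le_trans (ler_L2normB _ _)).
Qed.

Lemma bochner_norm_integrable D f : measurable D -> bochner_L1 D f ->
  mu.-integrable D (EFin \o (fun t => L2norm (f t))).
Proof.
move=> mD [sf fi]; apply/integrableP; split.
  by apply/measurable_EFinP; exact: strongly_measurable_norm.
by under eq_integral do rewrite /= ger0_norm ?L2norm_ge0//.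
Qed.

Lemma bochner_dot_integrable D f z : measurable D -> bochner_L1 D f ->
  mu.-integrable D (EFin \o (fun t => L2dot (f t) z)).
Proof.
move=> mD bf.
apply: (@le_integrable _ (measurableTypeR R) _ mu D mD _ (EFin \o (fun t => L2norm z * L2norm (f t)))) => //.
- by apply/measurable_EFinP; apply: strongly_measurable_dot; case: bf.
- move=> t Dt; rewrite /= lee_fin (le_trans (L2dot_norm _ _))//.
  by rewrite mulrC ler_norm.
- rewrite (_ : _ \o _ = (fun t => (L2norm z)%:E * (L2norm (f t))%:E)%E)//.
  by apply: integrableZl => //; exact: bochner_norm_integrable.
Qed.

Lemma continuous_L2_dot g z : continuous_L2 g -> forall T,
  {within `[0, T], continuous (fun t => L2dot (g t) z)}.
Proof.
move=> cg T; apply/subspace_continuousP => t /=; rewrite in_itv/= => /andP[t0 tT].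
apply/cvgrPdist_le => e e0; have [d d0 hd] := L2dot_small z e0.
have /cvgrPdist_le/(_ _ d0) := cg t t0.
rewrite !near_withinE; apply: filterS => r + /=.
rewrite in_itv/= => /[swap] /andP[r0 rT] /(_ r0).
rewrite distrC subr0 ger0_norm ?L2norm_ge0// => h.
by rewrite distrC -L2dotBl hd.
Qed.

(** Testing against a smoothed indicator of [s, t], whose derivative is a
    tent at [s] minus a tent at [t], recovers the increment of
    [fun r => L2dot (g r) z] between [s] and [t]; then [z := g t - g s] gives the
    norm of the increment. *)
Lemma weak_derivative_increment T g f s t : continuous_L2 g ->
  (forall d, 0 < d < T -> bochner_L1 `]d, T[ f) -> weak_derivative 0 T g f ->
  0 < s -> s <= t -> t < T ->
  L2norm (g t - g s) <= \int[mu]_(r in `[s, t]) L2norm (f r).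
Proof.
move=> cg bf wd s0; rewrite le_eqVlt => /predU1P[<- _|st tT].
  by rewrite subrr L2norm0 Rintegral_ge0// => r _; exact: L2norm_ge0.
set z := g t - g s; set I := (X in _ <= X).
pose p r := L2dot (g r) z.
have cp := continuous_L2_dot cg (z := z) (T := T).
suff H : L2norm z ^+ 2 <= L2norm z * I.
  have [->|z0] := eqVneq (L2norm z) 0.
    by rewrite Rintegral_ge0// => r _; exact: L2norm_ge0.
  by move: H; rewrite expr2 ler_pM2l// lt_neqAle eq_sym z0 L2norm_ge0.
have arith (A B C a b K e : R) : `|A - a| <= e / 2 -> `|B - b| <= e / 2 ->
    `|C| <= K -> A - B = - C -> b - a <= K + e.
  by rewrite !ler_norml => /andP[? ?] /andP[? ?] /andP[? ?] ?; lra.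
rewrite L2norm_sqr {1}/z L2dotBl; apply/ler_addgt0Pr => e e0.
have e2 : 0 < e / 2 by rewrite divr_gt0.
have near_p x : 0 < x -> x < T ->
    exists2 d : R, 0 < d & forall r, `|r - x| <= d -> `|p r - p x| <= e / 2.
  move=> x0 xT.
  have : {for x, continuous p}.
    apply: (within_continuous_continuous (lt_trans x0 xT) cp).
    by rewrite in_itv/= x0.
  move=> /cvgrPdist_le/(_ _ e2)/nbhs_ballP[d /= d0 hd].
  exists (d / 2); first by rewrite divr_gt0.
  move=> r rx; rewrite distrC; apply: hd; rewrite /ball/= distrC.
  by apply: le_lt_trans rx _; lra.
have [d1 d10 hd1] := near_p s s0 (lt_trans st tT).
have [d2 d20 hd2] := near_p t (lt_trans s0 st) tT.
pose d := Num.min (Num.min (d1 / 2) (d2 / 2)) ((t - s) / 2).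
have d0 : 0 < d by rewrite !lt_min !divr_gt0// subr_gt0.
have dd1 : 2 * d <= d1.
  by have : d <= d1 / 2; [rewrite /d !ge_min lexx|lra].
have dd2 : 2 * d <= d2.
  by have : d <= d2 / 2; [rewrite /d !ge_min lexx orbT|lra].
have dts : 2 * d <= t - s.
  by have : d <= (t - s) / 2; [rewrite /d !ge_min lexx orbT|lra].
pose phi r := step d s r - step d (t - 2 * d) r.
pose phi' r := tent d s r - tent d (t - 2 * d) r.
have dphi (r : R) : is_derive r 1 phi (phi' r).
  by apply: is_deriveB; exact: is_derive_step.
have phi'E : derive1 phi = phi'.
  by apply/funext => r; rewrite derive1E; have [] := dphi r.
have phi_out r : ~ (s <= r <= t) -> phi r = 0.
  move=> srt; rewrite /phi; have [rs|sr] := leP r s.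
    by rewrite !step_left ?subrr//; lra.
  have tr : t <= r by rewrite leNgt; apply/negP => rt; apply: srt; rewrite !ltW.
  by rewrite !step_right ?subrr//; lra.
have phi1 r : `|phi r| <= 1.
  have /andP[? ?] := step01 s r d0; have /andP[? ?] := step01 (t - 2 * d) r d0.
  by rewrite ler_norml /phi; apply/andP; split; lra.
have supp : closure [set r | phi r != 0] `<=` `[s, t]%classic.
  have /closure_id -> : closed `[s, t]%classic by exact: itv_closed.
  apply: closureS => r /= /eqP; apply: contra_notP.
  by rewrite in_itv/=; exact: phi_out.
have C : C1c 0 T phi.
  split.
  - by move=> r; have [] := dphi r.
  - rewrite phi'E => r; apply: cvgB; exact: continuous_tent.
  - apply: (@subclosed_compact _ _ `[s, t]%classic) => //.
      exact: closed_closure.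
    exact: segment_compact.
  - apply: subset_trans supp _ => r /=.
    by rewrite !in_itv/= => /andP[sr rt]; rewrite (lt_le_trans s0)//= (le_lt_trans rt).
have := wd phi z C; rewrite phi'E.
have [] := @tent_mean _ d s T p (p s) (e / 2) d0.
- exact: ltW.
- lra.
- exact: cp.
- by move=> r /andP[sr rs]; apply: hd1; rewrite ger0_norm; lra.
move=> i1 h1.
have [] := @tent_mean _ d (t - 2 * d) T p (p t) (e / 2) d0.
- lra.
- lra.
- exact: cp.
- by move=> r /andP[sr rs]; apply: hd2; rewrite ler0_norm; lra.
move=> i2 h2.
have -> : \int[mu]_(r in `]0, T[) (phi' r * L2dot (g r) z) =
    \int[mu]_(r in `]0, T[) (tent d s r * p r) -
    \int[mu]_(r in `]0, T[) (tent d (t - 2 * d) r * p r).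
  by rewrite -RintegralB//; apply: eq_Rintegral => r _; rewrite -mulrBl.
have sub_st : `[s, t]%classic `<=` `](s / 2), T[%classic.
  by move=> r /=; rewrite !in_itv/= => /andP[sr rt]; apply/andP; split; lra.
have bfs : bochner_L1 `]s / 2, T[ f by apply: bf; apply/andP; split; lra.
have ist (F : R -> R) : mu.-integrable `](s / 2), T[ (EFin \o F) ->
    mu.-integrable `[s, t] (EFin \o F).
  by move=> iF; exact: (@integrableS _ _ _ mu `]s / 2, T[%classic).
have iff := ist _ (bochner_norm_integrable (measurable_itv _) bfs).
have iq := ist _ (bochner_dot_integrable z (measurable_itv _) bfs).
have ipq : mu.-integrable `[s, t] (EFin \o (fun r => phi r * L2dot (f r) z)).
  apply: (@le_integrable _ (measurableTypeR R) _ mu _ _ _ (EFin \o (fun r => L2dot (f r) z))) => //.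
    apply/measurable_EFinP; apply: measurable_funM.
      apply: measurable_funTS; apply: continuous_measurable_fun => r.
      by apply: differentiable_continuous; apply/derivable1_diffP; have [] := dphi r.
    by move/integrableP : iq => [/measurable_EFinP].
  move=> r _; rewrite /= lee_fin normrM -[leRHS]mul1r ler_wpM2r//.
have -> : \int[mu]_(r in `]0, T[) (phi r * L2dot (f r) z) =
    \int[mu]_(r in `[s, t]) (phi r * L2dot (f r) z).
  rewrite [LHS]Rintegral_mkcond [RHS]Rintegral_mkcond; apply: eq_Rintegral => r _.
  rewrite !patchE; case: ifPn => [|]; rewrite ?notin_setE ?inE/= => r1.
    case: ifPn => //; rewrite notin_setE/= in_itv/= => /phi_out ->.
    by rewrite mul0r.
  rewrite memNset// => r2; apply: r1; move: r2; rewrite /= !in_itv/= => /andP[sr rt].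
  by apply/andP; split; lra.
have : `|\int[mu]_(r in `[s, t]) (phi r * L2dot (f r) z)| <= L2norm z * I.
  apply: (le_trans (le_normr_Rintegral _ ipq)) => //.
  rewrite /I -RintegralZl//; apply: le_Rintegral => //.
  - exact: integrable_norm.
  - rewrite (_ : _ \o _ = (fun t => (L2norm z)%:E * (L2norm (f t))%:E)%E)//.
    exact: integrableZl.
  - move=> r _; rewrite normrM -[leRHS]mul1r; apply: ler_pM => //.
    by rewrite mulrC; exact: L2dot_norm.
rewrite -/(p t) -/(p s); move: h1 h2.
exact: arith.
Qed.

End W11_facts.

(** * Uniqueness of strong solutions for convex functionals *)

Section uniqueness.
Context {R : realType}.
Notation mu := (@lebesgue_measure R).
Implicit Types (F : L2 R -> R) (g : R -> L2 R) (u v w : L2 R).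

Definition convex_L2 F := forall u w (l : R), 0 < l < 1 ->
  F (u + l *: (w - u)) <= F u + l * (F w - F u).

(** Going from [u] towards [w] by a factor [l -> 0] absorbs the o-term. *)
Lemma convex_subdiff F u v w : convex_L2 F -> subdiff F u v ->
  F u + L2dot v (w - u) <= F w.
Proof.
move=> cF Fuv; apply/ler_addgt0Pr => e e0.
pose k := L2norm (w - u) + 1.
have k0 : 0 < k by rewrite ltr_wpDl// L2norm_ge0.
have [d d0 hd] := Fuv (e / k) (divr_gt0 e0 k0).
pose l := Num.min (1 / 2) (d / (2 * k)).
have l0 : 0 < l by rewrite lt_min !divr_gt0// mulr_gt0.
have l1 : l < 1 by rewrite gt_min; apply/orP; left; lra.
have lk : l * k < d.
  have : l <= d / (2 * k) by rewrite /l ge_min lexx orbT.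
  rewrite ler_pdivlMr ?mulr_gt0// => h; nra.
have wu : u + l *: (w - u) - u = l *: (w - u) by rewrite addrC addKr.
have nk : l * L2norm (w - u) < d.
  by apply: le_lt_trans lk; rewrite ler_pM2l// /k lerDl.
have := hd (u + l *: (w - u)); rewrite wu L2normZ (gtr0_norm l0) => /(_ nk).
have l01 : 0 < l < 1 by rewrite l0.
have := cF u w l l01; rewrite L2dotZr.
have : e / k * (l * L2norm (w - u)) <= l * e.
  rewrite mulrCA ler_pM2l// -mulrA ger_pMr// ler_pdivrMl// mulr1 /k.
  by rewrite lerDl.
move: (F u) (F w) (F _) (L2dot v _) (_ * (l * _)) => a b c D E ? ? ?.
rewrite -(ler_pM2l l0); lra.
Qed.

Lemma subdiff_monotone F u1 u2 v1 v2 : convex_L2 F ->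
  subdiff F u1 v1 -> subdiff F u2 v2 -> 0 <= L2dot (v1 - v2) (u1 - u2).
Proof.
move=> cF /(convex_subdiff u2 cF) h1 /(convex_subdiff u1 cF) h2.
move: h1 h2; rewrite L2dotBl !L2dotBr.
move: (F u1) (F u2) (L2dot _ _) (L2dot _ _) (L2dot _ _) (L2dot _ _) => *; lra.
Qed.

Lemma strong_deriveB g1 g2 t v1 v2 :
  is_strong_derive g1 t v1 -> is_strong_derive g2 t v2 ->
  is_strong_derive (fun r => g1 r - g2 r) t (v1 - v2).
Proof.
move=> d1 d2.
apply: (@squeeze_cvgr _ _ _ _ (fun=> 0)
  (fun h => L2norm (h^-1 *: (g1 (t + h) - g1 t) - v1) +
            L2norm (h^-1 *: (g2 (t + h) - g2 t) - v2))).
- near=> h; rewrite L2norm_ge0/=.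
  rewrite -[X in _ <= _ + X]L2normN; apply: le_trans (ler_L2normD _ _).
  rewrite le_eqVlt; apply/orP; left; apply/eqP; congr L2norm.
  by apply/LfuneqP => s; rewrite !L2E; ring.
- exact: cvg_cst.
- by rewrite -[X in _ --> X](addr0 0); apply: cvgD.
Unshelve. all: by end_near. Qed.

(** The first-order expansion of the squared norm: its derivative is
    [2 * L2dot v (e t)].  The threshold [rho] makes the cross term with the
    remainder of [e] at most [eps / 2 * h], and the bound on [h] does the same for
    the quadratic term. *)
Lemma energy_dini (e : R -> L2 R) t v : is_strong_derive e t v ->
  L2dot v (e t) <= 0 -> forall eps, 0 < eps ->
  \forall h \near 0^'+, L2norm (e (t + h)) ^+ 2 <= L2norm (e t) ^+ 2 + eps * h.
Proof.
move=> dv ve eps eps0.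
set E := L2norm (e t); set V := L2norm v.
have E0 : 0 <= E by exact: L2norm_ge0.
have V0 : 0 <= V by exact: L2norm_ge0.
pose rho := Num.min 1 (eps / (4 * E + 4)).
have rho0 : 0 < rho by rewrite lt_min ltr01 divr_gt0// ltr_wpDl// mulr_ge0.
have rhoE : 4 * E * rho <= eps.
  have : rho <= eps / (4 * E + 4) by rewrite /rho ge_min lexx orbT.
  by rewrite ler_pdivlMr; nra.
have near_r : \forall h \near 0^'+,
    `|0 - L2norm (h^-1 *: (e (t + h) - e t) - v)| <= rho.
  have /cvgrPdist_le/(_ _ rho0) := dv; rewrite !near_withinE.
  by apply: filterS => h + h0; apply; rewrite gt_eqF.
have eta0 : 0 < eps / (2 * (V + 1) ^+ 2).
  by rewrite divr_gt0// mulr_gt0// exprn_gt0// ltr_wpDl.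
near=> h.
have h0 : 0 < h by near: h; exact: nbhs_right_gt.
have hs : h <= eps / (2 * (V + 1) ^+ 2) by near: h; exact: nbhs_right_le.
have : `|0 - L2norm (h^-1 *: (e (t + h) - e t) - v)| <= rho by near: h.
rewrite distrC subr0 ger0_norm ?L2norm_ge0//.
set r := _ - v => rrho.
have -> : e (t + h) = e t + h *: (v + r).
  by apply/LfuneqP => s; rewrite /r !L2E; field; rewrite gt_eqF.
rewrite !L2norm_sqr L2dotDl !L2dotDr !L2dotZl !L2dotZr (L2dotC v (e t)) in ve *.
have h1 : L2dot (e t) r <= E * L2norm r by exact: L2dot_le.
have h2 : L2dot (v + r) (v + r) <= (V + 1) ^+ 2.
  rewrite -L2norm_sqr ler_sqr ?nnegrE ?L2norm_ge0 ?addr_ge0//.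
  apply: le_trans (ler_L2normD _ _) _; rewrite lerD2l (le_trans rrho)//.
  by rewrite /rho ge_min lexx.
have h3 : E * L2norm r <= eps / 4.
  by have := ler_wpM2l E0 rrho; lra.
move: hs; rewrite ler_pdivlMr ?mulr_gt0 ?exprn_gt0 ?ltr_wpDl// => hs.
rewrite (L2dotC (v + r) (e t)) L2dotDr.
move: h1 h2 h3 ve hs.
move: (L2dot (e t) (e t)) (L2dot (e t) r) (L2dot (e t) v) (L2dot (v + r) _) (L2norm r).
move=> A B C D rn h1 h2 h3 ve hs.
have : h * (h * D) <= h * (eps / 2).
  rewrite ler_pM2l//; apply: (@le_trans _ _ (h * (V + 1) ^+ 2)); last lra.
  by rewrite ler_pM2l.
have : h * (C + B) <= h * (eps / 4) by rewrite ler_pM2l//; lra.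
lra.
Unshelve. all: by end_near. Qed.

Lemma W11_increment T g : continuous_L2 g -> W11 T g ->
  exists2 m : R -> R,
   (forall r, 0 <= m r) /\ (forall d, 0 < d < T -> mu.-integrable `]d, T[ (EFin \o m)) &
   forall s t, 0 < s -> s <= t -> t < T ->
     L2norm (g t - g s) <= \int[mu]_(r in `[s, t]) m r.
Proof.
move=> cg [_ [f [bf wd]]]; exists (fun r => L2norm (f r)).
  split; first by move=> r; exact: L2norm_ge0.
  by move=> d dT; apply: bochner_norm_integrable => //; exact: bf.
by move=> s t s0 st tT; exact: weak_derivative_increment bf wd _ _ _.
Qed.

(** By monotonicity of the subdifferential, the difference of two solutions
    satisfies the hypothesis of [energy_dini] almost everywhere.  The times are kept away from 0 because
    the weak derivatives need not be integrable there; absolute continuity of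
    the squared distance on [a, b] comes from the boundedness of the distance. *)
Lemma energy_noninc F g1 g2 (q : R -> R) a b : convex_L2 F ->
  strong_solution F q g1 -> strong_solution F q g2 -> 0 < a -> a <= b ->
  L2norm (g1 b - g2 b) ^+ 2 <= L2norm (g1 a - g2 a) ^+ 2.
Proof.
move=> cF [w1 c1 _ d1] [w2 c2 _ d2] a0 ab.
have b0 : 0 < b + 1 by rewrite ltr_wpDl// (le_trans (ltW a0)).
have [m1 [m10 im1] hm1] := W11_increment c1 (w1 _ b0).
have [m2 [m20 im2] hm2] := W11_increment c2 (w2 _ b0).
pose e r := g1 r - g2 r.
pose m r := m1 r + m2 r.
have m0 r : 0 <= m r by rewrite addr_ge0.
have a2 : 0 < a / 2 < b + 1 by apply/andP; split; lra.
have iab (f : R -> R) s t : a <= s -> t <= b ->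
    mu.-integrable `]a / 2, b + 1[ (EFin \o f) ->
    mu.-integrable `[s, t] (EFin \o f).
  move=> as_ tb; apply: (@integrableS _ _ _ mu `]a / 2, b + 1[%classic) => //.
  by move=> r /=; rewrite !in_itv/= => /andP[? ?]; apply/andP; split; lra.
have im s t : a <= s -> t <= b -> mu.-integrable `[s, t] (EFin \o m).
  move=> as_ tb; rewrite (_ : _ \o _ = (EFin \o m1) \+ (EFin \o m2))%E//.
  by apply: integrableD => //; apply: iab => //; [exact: im1 | exact: im2].
have em s t : a <= s -> s <= t -> t <= b ->
    L2norm (e t - e s) <= \int[mu]_(r in `[s, t]) m r.
  move=> as_ st tb; rewrite RintegralD//; last 2 first.
    by apply: iab => //; exact: im1.
    by apply: iab => //; exact: im2.
  have s0 : 0 < s by exact: lt_le_trans as_.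
  have tb1 : t < b + 1 by rewrite (le_lt_trans tb)// ltrDl.
  have := lerD (hm1 s t s0 st tb1) (hm2 s t s0 st tb1).
  apply: le_trans; rewrite -[X in _ <= _ + X]L2normN.
  apply: le_trans (ler_L2normD _ _).
  rewrite le_eqVlt; apply/orP; left; apply/eqP; congr L2norm.
  by apply/LfuneqP => x; rewrite !L2E; ring.
pose I := \int[mu]_(r in `[a, b]) m r.
have I0 : 0 <= I by exact: Rintegral_ge0.
pose C := 2 * (L2norm (e a) + I).
have C0 : 0 <= C by rewrite mulr_ge0// addr_ge0// L2norm_ge0.
have le_I t : a <= t -> t <= b -> \int[mu]_(r in `[a, t]) m r <= I.
  move=> at_ tb; rewrite /I /Rintegral fine_le//.
  - by apply: integrable_fin_num; [|exact: im].
  - by apply: integrable_fin_num; [|exact: im].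
  - apply: ge0_subset_integral => //.
    + by have /(measurable_int mu) := im a b (lexx _) (lexx _).
    + by move=> r _; rewrite lee_fin.
    + by move=> r /=; rewrite !in_itv/= => /andP[-> /le_trans]; exact.
have e_bound t : a <= t -> t <= b -> L2norm (e t) <= L2norm (e a) + I.
  move=> at_ tb; have := em a t (lexx _) at_ tb; have := le_I t at_ tb.
  have := ler_L2normB (e t) (e a); rewrite ler_norml => /andP[_].
  by move: (Rintegral _ _ _) => z *; lra.
apply: (@dini_noninc _ a b (fun r => L2norm (e r) ^+ 2) (fun r => C * m r)) => //.
- rewrite (_ : _ \o _ = (fun r => C%:E * (m r)%:E)%E)//.
  by apply: integrableZl => //; exact: im.
- by move=> t; rewrite mulr_ge0.
- move=> s t as_ st tb; rewrite RintegralZl//; last exact: im.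
  have := em s t as_ st tb.
  have := e_bound s as_ (le_trans st tb); have := e_bound t (le_trans as_ st) tb.
  have := ler_L2normB (e t) (e s); rewrite ler_norml => /andP[_].
  have := L2norm_ge0 (e t); have := L2norm_ge0 (e s); rewrite /C.
  have : 0 <= \int[mu]_(x in `[s, t]) m x by exact: Rintegral_ge0.
  move: (L2norm (e a) + I) (L2norm (e t)) (L2norm (e s)) (L2norm (e t - e s)) (Rintegral _ _ _).
  move=> K x y d z z0 y0 x0 xyd xK yK dz.
  have -> : x ^+ 2 - y ^+ 2 = (x - y) * (x + y) by ring.
  apply: (@le_trans _ _ (z * (x + y))); first by rewrite ler_wpM2r//; lra.
  by rewrite mulrC ler_wpM2r//; lra.
- move: d1 d2; apply: filterS2; first exact: (ae_filter_ringOfSetsType mu).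
  move=> t /= d1 d2 /andP[at_ tb].
  have t0 : 0 < t by exact: lt_trans at_.
  have [v1 dv1 Fv1] := d1 t0; have [v2 dv2 Fv2] := d2 t0.
  apply: (energy_dini (strong_deriveB dv1 dv2)).
  have := subdiff_monotone cF Fv1 Fv2.
  by rewrite -opprD L2dotNl oppr_ge0.
Qed.

(** [energy_noninc] starts at positive times only; continuity at 0 transports
    the coincidence of the initial values to small times. *)
Theorem strong_solution_unique F (q : R -> R) g1 g2 : convex_L2 F ->
  strong_solution F q g1 -> strong_solution F q g2 ->
  forall t, 0 <= t -> {ae leb01, forall s, g1 t s = g2 t s}.
Proof.
move=> cF s1 s2; have [w1 c1 i1 d1] := s1; have [w2 c2 i2 d2] := s2.
have i12 : {ae leb01, forall s, g1 0 s = g2 0 s}.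
  by move: i1 i2; apply: filterS2 => s -> ->.
move=> t; rewrite le_eqVlt => /predU1P[<-//|t0].
suff : L2norm (g1 t - g2 t) = 0.
  by move=> /L2norm_eq0; apply: filterS => s /eqP; rewrite subr_eq0 => /eqP.
have e00 : L2norm (g1 0 - g2 0) = 0.
  by apply: ae0_L2norm; apply: filterS i12 => s es; rewrite !L2E es subrr.
apply/eqP; rewrite eq_le L2norm_ge0 andbT; apply/ler_addgt0Pr => eps eps0.
have eps2 : 0 < eps / 2 by rewrite divr_gt0.
have /cvgrPdist_le/(_ _ eps2) := c1 0 (lexx _).
have /cvgrPdist_le/(_ _ eps2) := c2 0 (lexx _).
rewrite !near_withinE => n2 n1.
have : \forall a \near 0^'+, [/\ 0 < a, a <= t,
    0 <= a -> `|0 - L2norm (g1 a - g1 0)| <= eps / 2 &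
    0 <= a -> `|0 - L2norm (g2 a - g2 0)| <= eps / 2].
  near=> a; split.
  - by near: a; exact: nbhs_right_gt.
  - by near: a; exact: nbhs_right_le.
  - by near: a; exact: cvg_within n1.
  - by near: a; exact: cvg_within n2.
move=> /filter_ex[a [a0 at_ /(_ (ltW a0)) h1 /(_ (ltW a0)) h2]].
move: h1 h2; rewrite !(distrC 0) !subr0 !ger0_norm ?L2norm_ge0// => h1 h2.
have := energy_noninc cF s1 s2 a0 at_.
rewrite ler_sqr ?nnegrE ?L2norm_ge0// add0r => h; apply: (le_trans h).
have -> : g1 a - g2 a = (g1 a - g1 0) - (g2 a - g2 0) + (g1 0 - g2 0).
  by apply/LfuneqP => s; rewrite !L2E; ring.
apply: le_trans (ler_L2normD _ _) _; rewrite e00 addr0.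
by apply: le_trans (ler_L2normD _ _) _; rewrite L2normN; lra.
Unshelve. all: by end_near. Qed.

End uniqueness.

(** * Quantile functions *)

Section quantile_facts.
Context {R : realType}.
Notation mu := (@lebesgue_measure R).
Variable m : probability (measurableTypeR R) R.
Implicit Types (s x y : R).

Let idTR : measurableTypeR R -> R := idfun.

#[local] HB.instance Definition _ :=
  @isMeasurableFun.Build _ _ _ _ idTR (@measurable_id _ _ setT).

Let cdfE x : cdf (idTR : {RV m >-> R}) x = m `]-oo, x]%classic.
Proof. by []. Qed.

Lemma RplusE x : (Rplus m x)%:E = m `]-oo, x]%classic.
Proof. by rewrite /Rplus fineK// fin_num_measure. Qed.

Lemma Rplus_ge0 x : 0 <= Rplus m x.
Proof. by rewrite /Rplus fine_ge0. Qed.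

Lemma Rplus_le1 x : Rplus m x <= 1.
Proof. by rewrite -lee_fin RplusE probability_le1. Qed.

Lemma Rplus_nd x y : x <= y -> Rplus m x <= Rplus m y.
Proof.
by move=> xy; rewrite -lee_fin !RplusE -!cdfE; exact: cdf_nondecreasing.
Qed.

Lemma Rplus_y1 : Rplus m @ +oo --> (1 : R).
Proof. exact/fine_cvg/(cvg_cdfy1 (idTR : {RV m >-> R})). Qed.

Lemma Rplus_Ny0 : Rplus m @ -oo --> (0 : R).
Proof. exact/fine_cvg/(cvg_cdfNy0 (idTR : {RV m >-> R})). Qed.

Lemma Rplus_rc x : Rplus m y @[y --> x^'+] --> Rplus m x.
Proof.
apply: fine_cvg; rewrite RplusE.
have := @cdf_right_continuous _ _ _ m (idTR : {RV m >-> R}) x.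
by rewrite cdfE.
Qed.

(** The infimum is attained because the distribution function is right
    continuous. *)
Lemma quantile_min s : 0 < s < 1 ->
  s <= Rplus m (quantile m s) /\ lbound [set x | s <= Rplus m x] (quantile m s).
Proof.
move=> /andP[s0 s1]; rewrite /quantile; set A := [set x | s <= Rplus m x].
suff : exists x, A x /\ lbound A x by move=> /xgetPex; exact.
have A0 : A !=set0.
  have /cvgrPdist_lt/(_ (1 - s)) := Rplus_y1; rewrite subr_gt0 => /(_ s1) h.
  have [x hx] := filter_ex h.
  by exists x; rewrite /A/=; move: hx; rewrite ltr_norml => /andP[_ ?]; lra.
have Alb : has_lbound A.
  have /cvgrPdist_lt/(_ s s0) h := Rplus_Ny0; have [y hy] := filter_ex h.
  exists y => x /= Ax; rewrite leNgt; apply/negP => xy.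
  have := Rplus_nd (ltW xy); move: hy; rewrite add0r normrN ltr_norml => /andP[_ ?].
  by rewrite /A/= in Ax; lra.
have hA : has_inf A by split.
exists (inf A); split; last exact: inf_lbound.
rewrite /A/= -(cvg_lim _ (@Rplus_rc (inf A)))//.
apply: limr_ge; first by apply/cvg_ex; eexists; exact: Rplus_rc.
near=> y.
have Ay : inf A < y by near: y; exact: nbhs_right_gt.
have yA : 0 < y - inf A by rewrite subr_gt0.
have [x Ax xy] := inf_adherent yA hA.
by apply: le_trans Ax (Rplus_nd _); apply: ltW; rewrite subrKC in xy.
Unshelve. all: by end_near. Qed.

(** The Galois connection between a distribution function and its quantile
    function. *)
Lemma quantile_le s x : 0 < s < 1 -> (quantile m s <= x) = (s <= Rplus m x).
Proof.
move=> s01; have [h1 h2] := quantile_min s01; apply/idP/idP => h.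
  exact: le_trans h1 (Rplus_nd h).
exact: h2.
Qed.

(** Below 0 the set defining the quantile is the whole line and above 1 it is
    empty; only the value at 1 depends on the measure. *)
Lemma quantile_out s : ~ (0 < s < 1) -> s != 1 -> quantile m s = 0.
Proof.
move=> s01 s1; rewrite /quantile; case: xgetP => // x _ [/= Ax lb].
have [s0|s0] := leP s 0.
  have : s <= Rplus m (x - 1) by exact: le_trans s0 (Rplus_ge0 _).
  by move=> h; have := lb _ h; lra.
have : s <= 1 by exact: le_trans Ax (Rplus_le1 _).
by move=> s1'; case: s01; rewrite s0 lt_neqAle s1.
Qed.

Lemma measurable_quantile :
  measurable_fun [set: measurableTypeR R] (quantile m).
Proof.
have m01 : measurable_fun (`]0%R, 1%R[%classic : set (measurableTypeR R)) (quantile m).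
  apply: (measurability (@RGenCInfty.G R)) => [|/= _ [_] [r] -> <-].
    exact: RGenCInfty.measurableE.
  rewrite (_ : _ `&` _ = `]0, 1[ `&` [set s | r <= quantile m s]); last first.
    by congr (_ `&` _); apply/seteqP; split => s; rewrite /= in_itv/= andbT.
  apply: is_interval_measurable => s t /= [s01 rs] [t01 rt] u /andP[su ut].
  have u01 : 0 < u < 1.
    move: s01 t01; rewrite !in_itv/= => /andP[? ?] /andP[? ?].
    by apply/andP; split; lra.
  split; first by rewrite in_itv.
  apply: le_trans rs _; rewrite quantile_le//; apply: le_trans su _.
  by rewrite -quantile_le.
have -> : quantile m = (fun s => (quantile m \_ `]0%R, 1%R[) s +
    quantile m 1 * \1_[set 1%R] s).
  apply/funext => s; rewrite patchE; case: ifPn; rewrite ?inE ?notin_setE/= => s01.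
    rewrite indicE memNset ?mulr0 ?addr0//= => s1.
    by move: s01; rewrite in_itv/= s1 ltxx andbF.
  have [->|s1] := eqVneq s 1; first by rewrite indicE mem_set// mulr1 add0r.
  rewrite indicE memNset ?mulr0 ?addr0//=; last exact/eqP.
  by rewrite quantile_out// => ?; apply: s01; rewrite in_itv.
apply: measurable_funD.
  by apply/(measurable_restrictT _ _).1.
by apply: measurable_funM => //; exact: measurable_indic.
Qed.

Lemma leb01_quantile_le x : leb01 [set s | quantile m s <= x] = m `]-oo, x]%classic.
Proof.
rewrite -RplusE /leb01/= /mrestr.
have [R1|R1] := ltP (Rplus m x) 1.
  have -> : [set s | quantile m s <= x] `&` `]0, 1[ = `]0, Rplus m x]%classic.
    apply/seteqP; split => s /=; rewrite !in_itv/=.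
      by move=> [Qs /[dup] s01 /andP[-> _]]; rewrite -quantile_le.
    move=> /andP[s0 sR]; have s01 : 0 < s < 1 by rewrite s0 (le_lt_trans sR).
    by rewrite quantile_le.
  rewrite lebesgue_measure_itv/= lte_fin lt_neqAle eq_sym Rplus_ge0 andbT.
  by case: eqP => [->//|_]; rewrite oppr0 adde0.
have {}R1 : Rplus m x = 1 by apply/eqP; rewrite eq_le Rplus_le1.
have -> : [set s | quantile m s <= x] `&` `]0, 1[ = `]0%R, 1%R[%classic.
  apply/setIidr => s /=; rewrite in_itv/= => s01.
  by rewrite quantile_le// R1 ltW//; case/andP: s01.
by rewrite lebesgue_measure_itv/= lte_fin ltr01 R1 oppr0 adde0.
Qed.

Lemma eq_measure_cdf (P : {measure set (measurableTypeR R) -> \bar R}) :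
  (forall B, measurable B -> (P B < +oo)%E) ->
  (forall x, P `]-oo, x]%classic = m `]-oo, x]%classic) ->
  forall A, measurable A -> P A = m A.
Proof.
move=> Pf Pr A mA.
apply: (@measure_unique _ R (measurableTypeR R) (@ocitv R)
  (fun k : nat => `]-k%:R, k%:R]%classic) _ _ _ _ P m _ _ A mA) => //.
- exact: ocitvI.
- by move=> k; exact: is_ocitv.
- apply/seteqP; split => // x _; exists (Num.truncn `|x|).+1 => //=.
  have := truncnS_gt `|x|.
  by rewrite in_itv/= ltr_norml => /andP[-> /ltW ->].
- move=> _ [[a b] /= _ <-].
  have [ab|ba] := leP a b; last by rewrite set_itv_ge ?measure0// bnd_simp -leNgt ltW.
  have -> : `]a, b]%classic = `]-oo, b]%classic `\` `]-oo, a]%classic.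
    by rewrite -[RHS]setCK setCD setCitvl setUC -[LHS]setCK setCitv.
  have mf (B : set (measurableTypeR R)) : measurable B -> (m B < +oo)%E.
    by move=> mB; rewrite -ge0_fin_numE// fin_num_measure.
  rewrite [LHS]measureD ?[RHS]measureD//; [|exact: mf|exact: Pf].
  have -> : `]-oo, b]%classic `&` `]-oo, a]%classic = `]-oo, a]%classic.
    by apply/setIidr/subset_itvl; rewrite bnd_simp.
  by congr (_ - _)%E; exact: Pr.
- by move=> k; exact: Pf.
Qed.

(** Both sides agree on half-lines by [quantile_le], and half-lines determine a
    finite Borel measure. *)
Lemma pushforward_quantile (A : set (measurableTypeR R)) : measurable A ->
  leb01 (quantile m @^-1` A) = m A.
Proof.
have mq : @measurable_fun _ _ (measurableTypeR R) (measurableTypeR R)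
  setT (quantile m) by exact: measurable_quantile.
pose P := measure_function_pushforward__canonical__measure_function_Measure
  leb01 mq.
apply: (@eq_measure_cdf P) => [B mB|x].
  by apply: leb01_fin; rewrite -[X in measurable X]setTI; exact: measurable_quantile.
rewrite -leb01_quantile_le -[LHS]/(leb01 (quantile m @^-1` _)).
by congr (leb01 _); apply/seteqP; split => s /=; rewrite in_itv.
Qed.

Lemma quantile_transport (f : R -> \bar R) : measurable_fun setT f ->
  (forall x, 0 <= f x)%E ->
  (\int[leb01]_s f (quantile m s) = \int[m]_x f x)%E.
Proof.
move=> mf f0.
have mq : @measurable_fun _ _ (measurableTypeR R) (measurableTypeR R)
  setT (quantile m) by exact: measurable_quantile.
pose P := measure_function_pushforward__canonical__measure_function_Measure
  leb01 mq.
transitivity (\int[P]_x f x)%E.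
  by rewrite /P/= ge0_integral_pushforward// preimage_setT.
by apply: eq_measure_integral => A mA _; exact: pushforward_quantile.
Qed.

Lemma quantile_L2 : finite_second_moment m -> quantile m \in Lfun leb01 2%:E.
Proof.
move=> m2; apply: L2_mem; first exact: measurable_quantile.
rewrite (quantile_transport (f := fun x => (x ^+ 2)%:E))//.
  by apply/measurable_EFinP; exact: measurable_funX.
by move=> x; rewrite lee_fin sqr_ge0.
Qed.

End quantile_facts.

(** * Polygonal motions *)

Section polyline.
Context {R : realType}.
Implicit Types (t r : R).

(** The motion that starts at [a] and moves with velocity [vs j] during the time
    from [ts j] to [ts j.+1], for [j < N].  It is written as a sum of clamped
    motions, so that its dependence on time reduces to that of
    [fun t => Num.min t c]. *)
Definition pl_pos (N : nat) (a : R) (vs ts : nat -> R) t : R :=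
  a + \sum_(j < N) vs j * (Num.min t (ts j.+1) - Num.min t (ts j)).

Definition pl_vel (N : nat) (vs ts : nat -> R) t : R :=
  \sum_(j < N) vs j * ((t < ts j.+1)%R%:R - (t < ts j)%R%:R).

Lemma min_derive t c : t != c ->
  h^-1 * (Num.min (t + h) c - Num.min t c) @[h --> 0^'] --> ((t < c)%R%:R : R).
Proof.
move=> tc; apply: cvg_near_cst.
have [{}tc|ct|/eqP] := ltgtP t c; last by rewrite (negPf tc).
- near=> h.
  have h0 : h != 0 by near: h; exact: nbhs_dnbhs_neq.
  have hc : `|h| < c - t by near: h; apply: dnbhs0_lt; rewrite subr_gt0.
  move: hc; rewrite ltr_norml => /andP[? ?].
  by rewrite min_l; [rewrite (addrC t) addrK mulVf | lra].
- near=> h.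
  have hc : `|h| < t - c by near: h; apply: dnbhs0_lt; rewrite subr_gt0.
  move: hc; rewrite ltr_norml => /andP[? ?].
  by rewrite min_r; [rewrite subrr mulr0 | lra].
Unshelve. all: by end_near. Qed.

Lemma lt_right_cont t c : ((r < c)%R%:R : R) @[r --> t^'+] --> ((t < c)%R%:R : R).
Proof.
apply: cvg_near_cst; have [tc|ct] := ltP t c.
- by near=> r; rewrite (_ : r < c)//; near: r; exact: nbhs_right_lt.
- near=> r; rewrite ltNge (le_trans ct)//.
Unshelve. all: by end_near. Qed.

Lemma pl_vel_right_cont N vs ts t :
  pl_vel N vs ts r @[r --> t^'+] --> pl_vel N vs ts t.
Proof.
rewrite /pl_vel; apply: cvg_big => [|j _]; first exact: add_continuous.
by apply: cvgMr; apply: cvgB; exact: lt_right_cont.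
Qed.

Lemma pl_pos_derive N a vs ts t :
  (forall j, (j <= N)%N -> t != ts j) ->
  h^-1 * (pl_pos N a vs ts (t + h) - pl_pos N a vs ts t) @[h --> 0^'] -->
  pl_vel N vs ts t.
Proof.
move=> tts; rewrite /pl_pos /pl_vel.
under eq_fun do rewrite opprD addrACA subrr add0r -sumrB mulr_sumr.
apply: cvg_big => [|j _]; first exact: add_continuous.
have -> : (fun h => h^-1 *
      (vs j * (Num.min (t + h) (ts j.+1) - Num.min (t + h) (ts j)) -
       vs j * (Num.min t (ts j.+1) - Num.min t (ts j)))) =
    (fun h => vs j *
      (h^-1 * (Num.min (t + h) (ts j.+1) - Num.min t (ts j.+1)) -
       h^-1 * (Num.min (t + h) (ts j) - Num.min t (ts j)))).
  by apply/funext => h; ring.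
apply: cvgMr; apply: cvgB; apply: min_derive; apply: tts; case: j => j //=.
exact: ltnW.
Qed.

(** A motion through the nodes [xs 0], ..., [xs N]: the time spent between two
    nodes is the distance over the velocity. *)
Variables (N : nat) (xs vs ts : nat -> R).
Hypothesis ts0 : ts 0%N = 0.
Hypothesis tsS : forall j, (j < N)%N -> ts j.+1 = ts j + (xs j.+1 - xs j) / vs j.
Hypothesis dts : forall j, (j < N)%N -> 0 < (xs j.+1 - xs j) / vs j.
Let pos := pl_pos N (xs 0%N) vs ts.
Let vel := pl_vel N vs ts.

Lemma ts_lt j : (j < N)%N -> ts j < ts j.+1.
Proof. by move=> jN; rewrite tsS// ltrDl dts. Qed.

Lemma ts_le i j : (i <= j)%N -> (j <= N)%N -> ts i <= ts j.
Proof.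
elim: j => [|j IH]; first by rewrite leqn0 => /eqP ->.
rewrite leq_eqVlt => /predU1P[->//|ij] jN.
by apply: le_trans (IH ij (ltnW jN)) _; exact/ltW/ts_lt.
Qed.

Lemma ts_ge0 j : (j <= N)%N -> 0 <= ts j.
Proof. by move=> jN; rewrite -ts0; exact: ts_le. Qed.

Lemma pl_vs_neq0 j : (j < N)%N -> vs j != 0.
Proof.
by move=> jN; apply/eqP => v0; have := dts jN; rewrite v0 invr0 mulr0 ltxx.
Qed.

Lemma pl_pos_sum i t : (i <= N)%N -> ts i <= t ->
  xs 0%N + \sum_(j < i) vs j * (Num.min t (ts j.+1) - Num.min t (ts j)) = xs i.
Proof.
elim: i => [|i IH] iN it; first by rewrite big_ord0 addr0.
have ti : ts i <= t by apply: le_trans it; exact/ltW/ts_lt.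
rewrite big_ord_recr/= addrA IH//; last exact: ltnW.
by rewrite !min_r// tsS// [ts i + _]addrC addrK mulrC divfK ?pl_vs_neq0// subrKC.
Qed.

Lemma pl_pos_after t : ts N <= t -> pos t = xs N.
Proof. exact: pl_pos_sum. Qed.

Lemma pl_tail (F : nat -> R) i k : (i <= k)%N ->
  (forall j, (i <= j < k)%N -> F j = 0) -> \sum_(j < k) F j = \sum_(j < i) F j.
Proof.
elim: k => [|k IH]; first by rewrite leqn0 => /eqP ->.
rewrite leq_eqVlt => /predU1P[->//|ik] F0.
rewrite big_ord_recr/= F0 ?addr0; last by rewrite -ltnS ik /=.
by apply: IH => // j /andP[ij jk]; apply: F0; rewrite ij ltnW.
Qed.

Lemma pl_pos_piece i t : (i < N)%N -> ts i <= t -> t <= ts i.+1 ->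
  pos t = xs i + vs i * (t - ts i).
Proof.
move=> iN it ti; rewrite /pos /pl_pos.
rewrite (@pl_tail (fun j => vs j * (Num.min t (ts j.+1) - Num.min t (ts j))) i.+1)//.
  rewrite big_ord_recr/= addrA pl_pos_sum ?(ltnW iN)//.
  by rewrite min_l// min_r.
move=> j /andP[ij jN].
have tj : t <= ts j by apply: le_trans ti _; apply: ts_le ij _; exact: ltnW.
rewrite !min_l ?subrr ?mulr0//; apply: le_trans tj _; exact/ltW/ts_lt.
Qed.

Lemma pl_vel_piece i t : (i < N)%N -> ts i <= t -> t < ts i.+1 -> vel t = vs i.
Proof.
move=> iN it ti; rewrite /vel /pl_vel.
rewrite (@pl_tail (fun j => vs j * ((t < ts j.+1)%R%:R - (t < ts j)%R%:R)) i.+1)//.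
  rewrite big_ord_recr/= ti ltNge it/= subr0 mulr1 big1 ?add0r// => j _.
  have jt : ts j.+1 <= t by apply: le_trans it; apply: ts_le => //; exact: ltnW.
  have jt' : ts j <= t.
    by apply: le_trans jt; apply/ltW/ts_lt; apply: ltn_trans iN.
  by rewrite !ltNge jt jt' subrr mulr0.
move=> j /andP[ij jN].
have tj : t < ts j by apply: lt_le_trans ti _; apply: ts_le ij _; exact: ltnW.
by rewrite tj (lt_trans tj (ts_lt jN)) subrr mulr0.
Qed.

Lemma pl_vel_after t : ts N <= t -> vel t = 0.
Proof.
move=> Nt; rewrite /vel /pl_vel big1// => j _.
have jt : ts j.+1 <= t by apply: le_trans Nt; apply: ts_le.
have jt' : ts j <= t by apply: le_trans jt; exact/ltW/ts_lt.
by rewrite !ltNge jt jt' subrr mulr0.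
Qed.

Lemma locate t : 0 <= t ->
  (exists2 i, (i < N)%N & ts i <= t < ts i.+1) \/ ts N <= t.
Proof.
move=> t0; have [tN|Nt] := ltP t (ts N); last by right.
left; have ex : exists i, t < ts i by exists N.
case: (ex_minnP ex) => i ti imin.
have iN : (i <= N)%N by exact: imin.
case: i => [|i] in ti imin iN *; first by rewrite ts0 ltNge t0 in ti.
exists i => //; rewrite ti andbT leNgt; apply/negP => /imin.
by rewrite ltnn.
Qed.

Variable K : R.
Hypothesis K0 : 0 <= K.
Hypothesis vsK : forall j, (j < N)%N -> `|vs j| <= K.

Lemma min_incr r t a b : r <= t -> a <= b ->
  0 <= (Num.min t b - Num.min t a) - (Num.min r b - Num.min r a).
Proof.
move=> rt ab; rewrite /Num.min.
by case: (ltP t b); case: (ltP t a); case: (ltP r b); case: (ltP r a); lra.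
Qed.

(** Each clamped motion is monotone in time, so the increments add up without
    cancellation to at most [K] times the length of the clamped interval. *)
Lemma pl_lipschitz r t : `|pos t - pos r| <= K * `|t - r|.
Proof.
wlog rt : r t / r <= t.
  by case: (leP r t) => [|/ltW] h /(_ _ _ h)//; rewrite distrC (distrC t).
rewrite (ger0_norm (_ : 0 <= t - r)) ?subr_ge0//.
rewrite /pos /pl_pos opprD addrACA subrr add0r -sumrB.
apply: le_trans (ler_norm_sum _ _ _) _.
pose F j := Num.min t (ts j) - Num.min r (ts j).
apply: (@le_trans _ _ (\sum_(j < N) K * (F j.+1 - F j))).
  apply: ler_sum => -[j jN] _ /=; rewrite -mulrBr normrM.
  have := min_incr rt (ltW (ts_lt jN)) => h.
  rewrite (_ : F j.+1 - F j = Num.min t (ts j.+1) - Num.min t (ts j) -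
    (Num.min r (ts j.+1) - Num.min r (ts j))); last by rewrite /F; ring.
  by rewrite (ger0_norm h) ler_wpM2r// vsK.
rewrite -mulr_sumr; apply: ler_wpM2l => //.
rewrite -(big_mkord xpredT (fun j => F j.+1 - F j)) telescope_sumr//.
rewrite /F ts0; have := ts_ge0 (leqnn N); rewrite /Num.min.
by case: (ltP t (ts N)); case: (ltP t 0); case: (ltP r (ts N)); case: (ltP r 0); lra.
Qed.

Lemma pl_vel_bound t : `|vel t| <= K.
Proof.
have [t0|t0] := leP 0 t; last first.
  rewrite /vel /pl_vel big1 ?normr0// => -[j jN] _ /=.
  by rewrite !(lt_le_trans t0) ?subrr ?mulr0// ts_ge0// ltnW.
have [[i iN /andP[it ti]]|Nt] := locate t0.
  by rewrite (pl_vel_piece iN)// vsK.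
by rewrite pl_vel_after// normr0.
Qed.

End polyline.

(** * The discrete target measure *)

Section discrete.
Context {R : realType}.
Variables (n : nat) (x w : nat -> R).
Hypothesis hw : forall j, (1 <= j <= n)%N -> 0 < w j <= 1.
Hypothesis hw1 : \sum_(1 <= j < n.+1) w j = 1.
Hypothesis hx : forall j, (1 <= j < n)%N -> x j < x j.+1.
Implicit Types (s y : R) (i j k : nat).
Local Notation W := (cumw w).

Lemma w_ge0 j : (1 <= j < n.+1)%N -> 0 <= w j.
Proof. by move=> jn; apply/ltW; case/andP: (@hw j jn). Qed.

Lemma cumw0 : W 0 = 0. Proof. by rewrite /cumw big_geq. Qed.

Lemma cumwS k : W k.+1 = W k + w k.+1.
Proof. by rewrite /cumw big_nat_recr. Qed.

Lemma cumwn : W n = 1. Proof. exact: hw1. Qed.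

Lemma cumw_lt k : (k < n)%N -> W k < W k.+1.
Proof. by move=> kn; rewrite cumwS ltrDl; case/andP: (@hw k.+1 kn). Qed.

Lemma cumw_le i k : (i <= k)%N -> (k <= n)%N -> W i <= W k.
Proof.
elim: k => [|k IH]; first by rewrite leqn0 => /eqP ->.
rewrite leq_eqVlt => /predU1P[->//|ik] kn.
by apply: le_trans (IH ik (ltnW kn)) _; exact/ltW/cumw_lt.
Qed.

Lemma x_le i k : (0 < i)%N -> (i <= k)%N -> (k <= n)%N -> x i <= x k.
Proof.
move=> i0; elim: k => [|k IH]; first by rewrite leqn0 => /eqP ->.
rewrite leq_eqVlt => /predU1P[->//|ik] kn.
apply: le_trans (IH ik (ltnW kn)) _; apply/ltW/hx.
by rewrite (leq_trans i0).
Qed.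

Definition regular s := 0 < s < 1 /\ forall k, (1 <= k < n)%N -> s <> W k.

Lemma ell_spec s : regular s ->
  (1 <= ell n w s <= n)%N /\ W (ell n w s).-1 < s < W (ell n w s).
Proof.
move=> [/andP[s0 s1] sW]; rewrite /ell.
suff : exists l, (1 <= l <= n)%N /\ W l.-1 < s < W l by move=> /xgetPex; exact.
have ex : exists l, s < W l by exists n; rewrite cumwn.
case: (ex_minnP ex) => l sl lmin.
have ln : (l <= n)%N by apply: lmin; rewrite cumwn.
case: l => [|l] in sl lmin ln *; first by rewrite cumw0 ltNge ltW in sl.
exists l.+1; rewrite ln sl andbT; split => //=.
rewrite andbT.
have : W l <= s by rewrite leNgt; apply/negP => /lmin; rewrite ltnn.
rewrite le_eqVlt => /predU1P[Wl|//]; case: l => [|l] in Wl ln lmin sl *.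
  by move: s0; rewrite -Wl cumw0 ltxx.
by case: (sW l.+1) => //; rewrite ln.
Qed.

(** Existence of the index: the largest [k] with [x_k <= q0]. *)
Lemma kidx_up q0 q1 : q0 <= q1 -> let k := kidx n x q0 q1 in
  (k <= n)%N /\ (xbar n x k <= q0%:E < xbar n x k.+1)%E.
Proof.
move=> q01; rewrite /kidx q01 /=.
suff : exists k, (k <= n)%N /\ (xbar n x k <= q0%:E < xbar n x k.+1)%E.
  by move=> /xgetPex; exact.
pose P k := (k <= n)%N && (xbar n x k <= q0%:E)%E.
have ex : exists k, P k by exists 0%N; rewrite /P /xbar /= leNye.
have ub k : P k -> (k <= n)%N by case/andP.
case: (ex_maxnP ex ub) => k /andP[kn xk] kmax.
exists k; split => //; rewrite xk /= ltNge; apply/negP => xk1.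
have : (n < k.+1)%N.
  rewrite ltnNge; apply/negP => kn1; have : P k.+1 by rewrite /P kn1.
  by move=> /kmax; rewrite ltnn.
by move=> nk; move: xk1; rewrite /xbar/= leqNgt nk.
Qed.

(** Existence of the index: the smallest [k] with [q0 <= x_k]. *)
Lemma kidx_down q0 q1 : q1 < q0 -> let k := kidx n x q0 q1 in
  (1 <= k <= n.+1)%N /\ (xbar n x k.-1 < q0%:E <= xbar n x k)%E.
Proof.
move=> q10; rewrite /kidx leNgt q10 /=.
suff : exists k, (1 <= k <= n.+1)%N /\ (xbar n x k.-1 < q0%:E <= xbar n x k)%E.
  by move=> /xgetPex; exact.
have ex : exists k, (q0%:E <= xbar n x k)%E.
  by exists n.+1; rewrite /xbar/= ltnn leey.
case: (ex_minnP ex) => k xk kmin.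
have kn : (k <= n.+1)%N by apply: kmin; rewrite /xbar/= ltnn leey.
case: k => [|k] in xk kmin kn *; first by rewrite /xbar/= leeNy_eq in xk.
exists k.+1; rewrite kn xk andbT; split => //=.
by rewrite andbT ltNge; apply/negP => /kmin; rewrite ltnn.
Qed.

Lemma xbarE j : (1 <= j <= n)%N -> xbar n x j = (x j)%:E.
Proof. by case: j => // j /andP[_ jn]; rewrite /xbar /= jn. Qed.

(** ** The potential *)

Definition psi y : R := \sum_(1 <= j < n.+1) w j * `|y - x j|.

Lemma sum_sign k : (k <= n)%N ->
  \sum_(1 <= j < n.+1) w j * (if (j <= k)%N then 1 else -1) = 2 * W k - 1.
Proof.
move=> kn; rewrite (big_cat_nat _ (n := k.+1))//=.
have -> : \sum_(1 <= j < k.+1) w j * (if (j <= k)%N then 1 else -1) = W k.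
  by apply: eq_big_nat => j /andP[_]; rewrite ltnS => ->; rewrite mulr1.
have -> : \sum_(k.+1 <= j < n.+1) w j * (if (j <= k)%N then 1 else -1) =
    - \sum_(k.+1 <= j < n.+1) w j.
  rewrite -sumrN; apply: eq_big_nat => j /andP[kj _].
  by rewrite leqNgt kj mulrN1.
have := hw1; rewrite (big_cat_nat _ (n := k.+1))//= -/(W k).
by move: (\sum_(k.+1 <= j < n.+1) w j) => r; lra.
Qed.

(** If [y] lies in the k-th gap, the atoms to its left carry the mass [W k] and
    contribute the slope [W k], the others contribute [W k - 1]. *)
Lemma psi_subgrad k y y' : (k <= n)%N ->
  (forall j, (1 <= j <= k)%N -> x j <= y) ->
  (forall j, (k < j <= n)%N -> y <= x j) ->
  psi y + (2 * W k - 1) * (y' - y) <= psi y'.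
Proof.
move=> kn hl hr; rewrite -(sum_sign kn) mulr_suml -big_split/=.
rewrite /psi !big_nat; apply: ler_sum => j /andP[j1 jn].
have w0 : 0 <= w j by apply: w_ge0; rewrite j1.
rewrite -mulrA -mulrDr ler_wpM2l//; case: ifPn => jk.
  rewrite mul1r ger0_norm ?subr_ge0; last by rewrite hl// j1.
  by apply: le_trans (ler_norm _); lra.
rewrite mulN1r ler0_norm ?subr_le0; last by apply: hr; rewrite ltnNge jk.
by rewrite -normrN; apply: le_trans (ler_norm _); lra.
Qed.

Definition potential s y := (1 - 2 * s) * y + psi y.

Lemma potential_subgrad s k y y' : (k <= n)%N ->
  (forall j, (1 <= j <= k)%N -> x j <= y) ->
  (forall j, (k < j <= n)%N -> y <= x j) ->
  potential s y - 2 * (s - W k) * (y' - y) <= potential s y'.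
Proof.
by move=> kn hl hr; have := psi_subgrad y' kn hl hr; rewrite /potential; lra.
Qed.

(** At the point [x l] both adjacent gaps provide a slope, and they have opposite
    signs exactly when [W l.-1 < s < W l]. *)
Lemma potential_min s y' : regular s -> let y := x (ell n w s) in
  potential s y <= potential s y'.
Proof.
move=> rs; have [/andP[l1 ln] /andP[sl sr]] := ell_spec rs.
move: l1 ln sl sr; set l := ell n w s => l1 ln sl sr /=.
have h1 : potential s (x l) - 2 * (s - W l) * (y' - x l) <= potential s y'.
  apply: potential_subgrad => // j /andP[j1 j2]; first exact: x_le.
  by apply: x_le => //; exact: ltnW.
have h2 : potential s (x l) - 2 * (s - W l.-1) * (y' - x l) <= potential s y'.
  apply: potential_subgrad => [|j /andP[j1 j2]|j /andP[j1 j2]]; first lia.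
    by apply: x_le => //; lia.
  by apply: x_le => //; lia.
by have [yl|ly] := leP y' (x l); nra.
Qed.

Lemma convex_psi y y' l : 0 < l < 1 ->
  psi (y + l * (y' - y)) <= psi y + l * (psi y' - psi y).
Proof.
move=> /andP[l0 l1]; rewrite /psi -sumrB mulr_sumr -big_split/= !big_nat.
apply: ler_sum => j jn; have w0 := w_ge0 jn.
have -> : w j * `|y - x j| + l * (w j * `|y' - x j| - w j * `|y - x j|) =
  w j * ((1 - l) * `|y - x j| + l * `|y' - x j|) by ring.
apply: ler_wpM2l => //.
have -> : y + l * (y' - y) - x j = (1 - l) * (y - x j) + l * (y' - x j) by ring.
apply: le_trans (ler_normD _ _) _; rewrite !normrM (gtr0_norm l0) ger0_norm//.
by rewrite subr_ge0 ltW.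
Qed.

(** ** The motion of one particle *)

Section motion.
Variables (q0 s : R).
Hypothesis rs : regular s.
Let l := ell n w s.
Let q1 := x l.
Local Notation k := (kidx n x q0 q1).
Local Notation N := (nsteps n x w q0 q1 s).

Definition node (j : nat) : R := if j == 0%N then q0 else xstep n x q0 q1 j.
Definition speed (j : nat) : R := 2 * (s - Rstep n x w q0 q1 j).
Local Notation ts := (tstep n x w q0 q1 s).

Lemma tstepS j : ts j.+1 = ts j + (node j.+1 - node j) / speed j.
Proof. by case: j => [|j] //=; rewrite add0r. Qed.

Let between a (A B : R) : 0 <= a < 1 -> A <= B -> A <= A + a * (B - A) <= B.
Proof. by move=> /andP[a0 a1] AB; apply/andP; split; nra. Qed.

Let between' a (A B : R) : 0 <= a < 1 -> B <= A -> B <= A + a * (B - A) <= A.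
Proof. by move=> /andP[a0 a1] AB; apply/andP; split; nra. Qed.

(** The [j]-th piece of the motion runs inside the closure of the gap [g], with the
    velocity prescribed by this gap, which points from the first to the second
    node of the piece.  Both directions of motion are treated alike from here on. *)
Definition crosses g j := [/\ (g <= n)%N, speed j = 2 * (s - W g),
   0 < (node j.+1 - node j) / speed j &
   forall a, 0 <= a < 1 ->
     let y := node j + a * (node j.+1 - node j) in
     (forall i, (1 <= i <= g)%N -> x i <= y) /\
     (forall i, (g < i <= n)%N -> y <= x i)].

Lemma kidx_le_ell : q0 <= q1 -> (k <= l)%N.
Proof.
move=> q01; have [/andP[l1 ln] _] := ell_spec rs; rewrite -/l in l1 ln.
have [kn /andP[xk _]] := kidx_up q01.
rewrite leqNgt; apply/negP => lk; move: xk.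
rewrite xbarE ?lee_fin; last by rewrite kn (leq_trans l1)// ltnW.
move=> xk; have : x l < x l.+1 by apply: hx; rewrite l1 (leq_trans lk).
have := x_le (ltn0Sn l) lk kn; rewrite /q1 in q01; lra.
Qed.

Lemma ell_lt_kidx : q1 < q0 -> (l < k)%N.
Proof.
move=> q10; have [/andP[l1 ln] _] := ell_spec rs; rewrite -/l in l1 ln.
have [/andP[k1 kn] /andP[_ xk]] := kidx_down q10.
rewrite ltnNge; apply/negP => kl; move: xk.
rewrite xbarE ?lee_fin; last by rewrite k1 (leq_trans kl).
by have := x_le k1 kl ln; rewrite /q1 in q10; lra.
Qed.

Lemma nsteps_up : q0 <= q1 -> N = (l - k)%N.
Proof. by move=> /kidx_le_ell kl; rewrite /nsteps -/l distnEl. Qed.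

Lemma nsteps_down : q1 < q0 -> N = (k - l)%N.
Proof. by move=> /ell_lt_kidx/ltnW kl; rewrite /nsteps -/l distnEr. Qed.

Lemma crosses_up j : q0 <= q1 -> (j < N)%N -> crosses (k + j) j.
Proof.
move=> q01; have kl := kidx_le_ell q01.
have [/andP[l1 ln] /andP[sl sr]] := ell_spec rs; rewrite -/l in l1 ln sl sr.
have [kn /andP[xk xk1]] := kidx_up q01.
rewrite nsteps_up// => jN; have jl : (k + j < l)%N by rewrite -ltn_subRL.
have speedE : speed j = 2 * (s - W (k + j)) by rewrite /speed /Rstep q01.
have Ws : W (k + j) < s by apply: le_lt_trans sl; apply: cumw_le; lia.
have nodeS i : node i.+1 = x (k + i).+1 by rewrite /node/= /xstep q01 addnS.
have nodej : node j < node j.+1.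
  rewrite nodeS; case: j => [|j] in jN jl Ws speedE *.
    by move: xk1; rewrite /node/= addn0 xbarE ?lte_fin//; lia.
  by rewrite nodeS addnS; apply: hx; lia.
have le_node i : (1 <= i <= k + j)%N -> x i <= node j.
  move=> /andP[i1 ij]; case: j => [|j] in jN jl ij Ws speedE nodej *.
    apply: (@le_trans _ _ (x k)); first by apply: x_le; lia.
    by move: xk; rewrite /node/= xbarE ?lee_fin//; lia.
  by rewrite nodeS; apply: x_le; lia.
split; first lia.
- exact: speedE.
- by rewrite divr_gt0 ?subr_gt0// speedE mulr_gt0// subr_gt0.
- move=> a a01; have /= /andP[y1 y2] := between a01 (ltW nodej); split => i ij.
    exact: le_trans (le_node i ij) y1.
  by apply: le_trans y2 _; rewrite nodeS; apply: x_le; move: ij; clear; lia.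
Qed.

Lemma crosses_down j : q1 < q0 -> (j < N)%N -> crosses (k - j - 1) j.
Proof.
move=> q10; have kl := ell_lt_kidx q10.
have [/andP[l1 ln] /andP[sl sr]] := ell_spec rs; rewrite -/l in l1 ln sl sr.
have [/andP[k1 kn] /andP[xk xk1]] := kidx_down q10.
have q01 : (q0 <= q1) = false by rewrite leNgt q10.
rewrite nsteps_down// => jN.
have jl : (l <= k - j - 1)%N by move: jN; clear; lia.
have speedE : speed j = 2 * (s - W (k - j - 1)) by rewrite /speed /Rstep q01.
have Ws : s < W (k - j - 1) by apply: lt_le_trans sr _; apply: cumw_le; lia.
have nodeS i : node i.+1 = x (k - i - 1) by rewrite /node/= /xstep q01 -subnDA addn1.
have nodej : node j.+1 < node j.
  rewrite nodeS; case: j => [|j] in jN jl Ws speedE *.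
    by move: xk; rewrite /node/= subn0 subn1 xbarE ?lte_fin//; lia.
  rewrite nodeS (_ : (k - j - 1 = (k - j.+1 - 1).+1)%N); last lia.
  by apply: hx; lia.
have le_node i : (k - j - 1 < i <= n)%N -> node j <= x i.
  move=> /andP[i1 ij]; case: j => [|j] in jN jl i1 Ws speedE nodej *.
    apply: (@le_trans _ _ (x k)); last by apply: x_le; lia.
    by move: xk1; rewrite /node/= xbarE ?lee_fin//; lia.
  by rewrite nodeS; apply: x_le; lia.
split; first lia.
- exact: speedE.
- rewrite -[X in 0 < X]mulrNN -invrN divr_gt0 ?oppr_gt0 ?subr_lt0//.
  by rewrite speedE pmulr_rlt0// subr_lt0.
- move=> a a01; have /= /andP[y1 y2] := between' a01 (ltW nodej); split => i ij.
    by apply: le_trans y1; rewrite nodeS; apply: x_le; move: ij jl kl kn; clear; lia.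
  exact: le_trans y2 (le_node i ij).
Qed.

Lemma motion_crosses j : (j < N)%N -> exists g, crosses g j.
Proof.
move=> jN; have [q01|q10] := leP q0 q1.
  by exists (k + j)%N; exact: crosses_up.
by exists (k - j - 1)%N; exact: crosses_down.
Qed.

(** The particle stops at the minimizer of the potential.  When there is no
    piece at all, [kidx] equals [ell] and forces [q0 = q1]. *)
Lemma node_last : node N = q1.
Proof.
have [/andP[l1 ln] _] := ell_spec rs; rewrite -/l in l1 ln.
have [q01|q10] := leP q0 q1.
  have kl := kidx_le_ell q01; rewrite nsteps_up// /node /xstep q01.
  case: eqP => N0; last by rewrite subnKC.
  have [kn /andP[xk _]] := kidx_up q01; move: xk.
  have kl' : k = l by apply/eqP; rewrite eqn_leq kl -subn_eq0 N0.
  rewrite kl' xbarE ?l1// lee_fin => xl.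
  by apply/eqP; rewrite eq_le q01.
have kl := ell_lt_kidx q10; rewrite nsteps_down// /node /xstep (leNgt q0) q10 /=.
by rewrite subn_eq0 leqNgt kl subKn// ltnW.
Qed.

Lemma motion_dts j : (j < N)%N -> 0 < (node j.+1 - node j) / speed j.
Proof. by move=> /motion_crosses[g []]. Qed.

Lemma cumw01 g : (g <= n)%N -> 0 <= W g <= 1.
Proof.
move=> gn; rewrite -cumw0 -cumwn; apply/andP.
by split; apply: cumw_le.
Qed.

Lemma motion_speed j : (j < N)%N -> `|speed j| <= 2.
Proof.
move=> /motion_crosses[g [gn -> _ _]]; have /andP[g0 g1] := cumw01 gn.
case: rs => /andP[s0 s1] _.
by rewrite ler_norml; apply/andP; split; lra.
Qed.

Let pos t := pl_pos N q0 speed ts t.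
Let vel t := pl_vel N speed ts t.

Let posE t : pos t = pl_pos N (node 0) speed ts t. Proof. by []. Qed.

(** Inside a gap this is [potential_subgrad], the velocity being minus the slope
    of the gap; after the last node it is the minimality of [x l].  At a node
    the right continuous velocity belongs to the gap that is entered. *)
Lemma motion_subgrad t y' : 0 <= t ->
  potential s (pos t) - vel t * (y' - pos t) <= potential s y'.
Proof.
move=> t0; rewrite posE.
have tsS i : (i < N)%N -> ts i.+1 = ts i + (node i.+1 - node i) / speed i.
  by move=> _; exact: tstepS.
have [[i iN /andP[it ti]]|Nt] := @locate _ N ts (erefl _) _ t0.
  rewrite /vel (@pl_vel_piece _ N node speed ts tsS motion_dts i t)//.
  rewrite (@pl_pos_piece _ N node speed ts tsS motion_dts i t)//; last exact: ltW.
  have [g [gn speedE dpos h]] := motion_crosses iN.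
  have v0 : speed i != 0.
    by apply/eqP => v0; move: dpos; rewrite v0 invr0 mulr0 ltxx.
  have d0 : node i.+1 - node i != 0.
    by apply/eqP => v1; move: dpos; rewrite v1 mul0r ltxx.
  pose a := (t - ts i) / ((node i.+1 - node i) / speed i).
  have a01 : 0 <= a < 1.
    rewrite /a divr_ge0 ?subr_ge0 ?(ltW dpos)//= ltr_pdivrMr// mul1r.
    by move: ti; rewrite tsS//; lra.
  have yE : node i + speed i * (t - ts i) = node i + a * (node i.+1 - node i).
    by rewrite /a; field; rewrite d0 v0.
  have [h1 h2] := h a a01; rewrite yE speedE.
  exact: potential_subgrad.
rewrite /vel (@pl_vel_after _ N node speed ts tsS motion_dts t)//.
rewrite (@pl_pos_after _ N node speed ts tsS motion_dts t)//.
by rewrite mul0r subr0 node_last; exact: potential_min.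
Qed.

Lemma motion_explicit : explicit_trajectory n x w q0 q1 s pos.
Proof.
have tsS i : (i < N)%N -> ts i.+1 = ts i + (node i.+1 - node i) / speed i.
  by move=> _; exact: tstepS.
have piece i t : (i < N)%N -> ts i <= t < ts i.+1 -> pos t = node i + speed i * (t - ts i).
  move=> iN /andP[it ti]; rewrite posE (@pl_pos_piece _ N node speed ts tsS motion_dts i t)//.
  exact: ltW.
split.
- by move=> N0 t /(piece _ _ N0) ->; rewrite subr0.
- by move=> [//|j] /andP[_ jN] t /(piece _ _ jN) ->.
- move=> t Nt; rewrite posE (@pl_pos_after _ N node speed ts tsS motion_dts t)//.
  exact: node_last.
Qed.

Lemma motion_lipschitz t r : `|pos t - pos r| <= 2 * `|t - r|.
Proof.
rewrite !posE; apply: (@pl_lipschitz _ N node) => //.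
- by move=> i _; exact: tstepS.
- exact: motion_dts.
- exact: motion_speed.
Qed.

Lemma motion_vel_bound t : `|vel t| <= 2.
Proof.
apply: (@pl_vel_bound _ N node) => //.
- by move=> i _; exact: tstepS.
- exact: motion_dts.
- exact: motion_speed.
Qed.

End motion.

(** ** The quantile function and the functional *)

Variable nu : probability (measurableTypeR R) R.
Hypothesis hnu : forall A : set (measurableTypeR R), measurable A ->
  nu A = (\sum_(1 <= j < n.+1) (w j)%:E * \d_(x j) A)%E.

Lemma Rplus_nu y : Rplus nu y = \sum_(1 <= j < n.+1) w j * (x j <= y)%R%:R.
Proof.
rewrite /Rplus hnu//.
rewrite (eq_bigr (fun j => (w j * (x j <= y)%R%:R)%:E)) ?sumEFin// => j _.
rewrite diracE -EFinM.
have -> // : (x j \in `]-oo, y]%classic) = (x j <= y).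
by apply/idP/idP; rewrite inE/= in_itv.
Qed.

(** The first atom at which the cumulated weight reaches [s]. *)
Lemma quantile_nu s : regular s -> quantile nu s = x (ell n w s).
Proof.
move=> rs; have [/andP[l1 ln] /andP[sl sr]] := ell_spec rs.
move: l1 ln sl sr; set l := ell n w s => l1 ln sl sr.
have s01 : 0 < s < 1 by case: rs.
have key y : (s <= Rplus nu y) = (x l <= y).
  rewrite Rplus_nu; apply/idP/idP => h.
    rewrite leNgt; apply/negP => yl; move: h; apply/negP; rewrite -ltNge.
    apply: le_lt_trans sl; rewrite (big_cat_nat _ (n := l))//=; last lia.
    have -> : \sum_(l <= j < n.+1) w j * (x j <= y)%R%:R = 0.
      rewrite big_nat big1// => j /andP[lj jn].
      by rewrite leNgt (lt_le_trans yl) ?mulr0//; apply: x_le; lia.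
    rewrite addr0.
    rewrite /cumw prednK// !big_nat; apply: ler_sum => j /andP[j1 jl].
    have : 0 <= w j by apply: w_ge0; lia.
    by case: (x j <= y); rewrite ?mulr1 ?mulr0.
  apply: (le_trans (ltW sr)); rewrite /cumw [leRHS](big_cat_nat _ (n := l.+1))//=.
  rewrite -[leLHS]addr0 lerD//.
    rewrite !big_nat; apply: ler_sum => j /andP[j1 jl].
    by rewrite (le_trans _ h) ?mulr1//; apply: x_le; lia.
  rewrite big_nat sumr_ge0// => j /andP[j1 jn].
  by rewrite mulr_ge0// w_ge0//; lia.
have h1 : quantile nu s <= x l by rewrite quantile_le// key.
have h2 : x l <= quantile nu s by rewrite -key -quantile_le.
by apply/eqP; rewrite eq_le h1.
Qed.

Lemma integral_nu (f : R -> \bar R) : measurable_fun setT f ->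
  (forall z, 0 <= f z)%E ->
  (\int[nu]_z f z = \sum_(1 <= j < n.+1) (w j)%:E * f (x j))%E.
Proof.
move=> mf f0.
pose d (j : nat) : {measure set (measurableTypeR R) -> \bar R} :=
  mscale (NngNum (normr_ge0 (w j.+1))) (@dirac _ (measurableTypeR R) (x j.+1) R).
have wE j : (j < n)%N -> `|w j.+1| = w j.+1.
  by move=> jn; rewrite ger0_norm// w_ge0.
rewrite (eq_measure_integral (msum d n)); last first.
  move=> A mA _; transitivity (\sum_(1 <= j < n.+1) (w j)%:E * \d_(x j) A)%E.
    exact: hnu.
  rewrite big_add1/= big_mkord /msum.
  by apply: eq_bigr => -[j jn] _; rewrite /= /mscale/= wE.
rewrite ge0_integral_measure_sum// big_add1/= big_mkord.
apply: eq_bigr => -[j jn] _ /=.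
rewrite ge0_integral_mscale// integral_dirac// diracT mul1e.
by rewrite /= wE.
Qed.

Lemma integral_quantile_nu y : \int[leb01]_t `|y - quantile nu t| = psi y.
Proof.
have mf : measurable_fun [set: R] (fun z => `|y - z|%:E).
  apply/measurable_EFinP; apply: measurableT_comp => //.
  exact: measurable_funB.
rewrite /Rintegral (quantile_transport nu (f := fun z => `|y - z|%:E))//.
by rewrite integral_nu//; under eq_bigr do rewrite -EFinM; rewrite sumEFin.
Qed.

(** The inner integral is an integral against [nu], which is a finite sum. *)
Lemma FnuE (u : L2 R) : Fnu nu u = \int[leb01]_s potential s (u s).
Proof.
by apply: eq_Rintegral => s _; rewrite integral_quantile_nu.
Qed.

Lemma potential_integrable (u : L2 R) :
  leb01.-integrable setT (EFin \o (fun s => potential s (u s))).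
Proof.
have iu := L2_integrable u.
have -> : (fun s => potential s (u s)) = (fun s => (u s - 2 * (L2_id s * u s)) +
    \sum_(j < n) w j.+1 * `|u s - x j.+1|).
  apply/funext => s; rewrite /potential /psi big_add1/= big_mkord; congr (_ + _).
  by rewrite mulrBl mul1r mulrA.
apply: EFin_integrableD => //.
  apply: EFin_integrableB => //; apply: EFin_integrableZl => //.
  exact: L2_integrableM.
apply: EFin_integrable_sum => // j; apply: EFin_integrableZl => //.
apply: (@integrable_norm _ _ _ leb01); apply: EFin_integrableB => //.
exact: leb01_integrable_cst.
Qed.

Lemma convex_Fnu : convex_L2 (Fnu nu).
Proof.
move=> u v l l01; rewrite !FnuE.
have iu := potential_integrable u; have iv := potential_integrable v.
have iB := EFin_integrableB measurableT iv iu.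
have iZ := EFin_integrableZl measurableT l iB.
rewrite -RintegralB// -RintegralZl// -RintegralD//.
apply: le_Rintegral => //; first exact: potential_integrable.
  exact: EFin_integrableD.
move=> s _; rewrite !L2E /potential.
by have := convex_psi (u s) (v s) l01; lra.
Qed.

(** Integration of the pointwise subgradient inequalities at [y' := z s]; for
    a convex problem no o-term has to be spent, so any [delta] will do. *)
Lemma subdiff_Fnu (u v : L2 R) :
  {ae leb01, forall s, forall y', potential s (u s) + v s * (y' - u s) <= potential s y'} ->
  subdiff (Fnu nu) u v.
Proof.
move=> H eps eps0; exists 1 => // z _.
apply: (@le_trans _ _ (Fnu nu u + L2dot v (z - u))).
  by rewrite gerBl mulr_ge0 ?L2norm_ge0// ltW.
rewrite !FnuE /L2dot -RintegralD//; last 2 first.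
  exact: potential_integrable.
  exact: L2_integrableM.
apply: ae_le_Rintegral => //.
- apply: EFin_integrableD => //; first exact: potential_integrable.
  exact: L2_integrableM.
- exact: potential_integrable.
- move: H; apply: filterS; first exact: (ae_filter_ringOfSetsType leb01).
  by move=> s; rewrite !L2E; apply.
Qed.

End discrete.

(** * Convergence in L_2(0,1) *)

Section L2_convergence.
Context {R : realType}.
Notation mu := (@lebesgue_measure R).
Implicit Types (u v : L2 R) (C : R).

Lemma L2_mem_le (f : R -> R) u C : measurable_fun [set: measurableTypeR R] f ->
  (forall s, `|f s| <= `|u s| + C) -> f \in Lfun leb01 2%:E.
Proof.
move=> mf fu; apply: L2_mem => //.
have i : leb01.-integrable setT (EFin \o (fun s => 2 * (u s * u s) + 2 * C ^+ 2)).
  apply: EFin_integrableD => //; last exact: leb01_integrable_cst.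
  by apply: EFin_integrableZl => //; exact: L2_integrableM.
have [mi ifin] := integrableP _ _ _ i; apply: le_lt_trans ifin.
apply: ge0_le_integral => //.
- by move=> s _; rewrite lee_fin sqr_ge0.
- by apply/measurable_EFinP; exact: measurable_funX.
- exact: measurableT_comp.
move=> s _; rewrite /= lee_fin; apply: le_trans (ler_norm _).
have := fu s; have := normr_ge0 (f s).
rewrite -(real_normK (num_real (f s))) -expr2 -(real_normK (num_real (u s))).
move: (`|f s|) (`|u s|) => a b a0 ab.
have : a ^+ 2 <= (b + C) ^+ 2 by rewrite ler_sqr ?nnegrE// (le_trans a0).
have : 0 <= (b - C) ^+ 2 by exact: sqr_ge0.
by nra.
Qed.

Lemma L2norm_le u C : 0 <= C -> {ae leb01, forall s, `|u s| <= C} -> L2norm u <= C.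
Proof.
move=> C0 uC; rewrite -ler_sqr ?nnegrE ?L2norm_ge0// L2norm_sqr /L2dot.
have -> : C ^+ 2 = \int[leb01]_s (C ^+ 2).
  by rewrite Rintegral_cst// [fine _](_ : _ = 1) ?mulr1// leb01T.
apply: ae_le_Rintegral; [exact: L2_integrableM|exact: leb01_integrable_cst|].
move: uC; apply: filterS => s us; rewrite -expr2 -(real_normK (num_real (u s))).
by rewrite ler_sqr ?nnegrE.
Qed.

Lemma L2_dominated (u_ : nat -> L2 R) C :
  (forall n, {ae leb01, forall s, `|u_ n s| <= C}) ->
  {ae leb01, forall s, u_ n s @[n --> \oo] --> 0} ->
  L2norm (u_ n) @[n --> \oo] --> 0.
Proof.
move=> uC u0.
have := @dominated_convergence _ (measurableTypeR R) R leb01 setT measurableT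
  (fun n s => (u_ n s * u_ n s)%:E) (cst 0%E) (EFin \o cst (C ^+ 2)).
case.
- by move=> n; have [] := integrableP _ _ _ (L2_integrableM (u_ n) (u_ n)).
- exact: measurable_cst.
- move: u0; apply: filterS => s us _; apply: cvg_EFin; first exact: nearW.
  by rewrite -[X in _ --> X](mulr0 0); apply: cvgM.
- exact: leb01_integrable_cst.
- move/ae_foralln : uC; apply: filterS => s us n _; rewrite /= lee_fin -expr2 normrX.
  by rewrite ler_sqr ?nnegrE// (le_trans _ (us n)).
move=> _ _; rewrite integral0 => /fine_cvgP[_ h].
have -> : (fun n => L2norm (u_ n)) = (fun n => Num.sqrt (L2dot (u_ n) (u_ n))).
  by apply/funext => n; rewrite L2normE.
have : Num.sqrt (L2dot (u_ n) (u_ n)) @[n --> \oo] --> Num.sqrt (0 : R).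
  exact: (cvg_comp _ _ h (@sqrt_continuous R 0)).
by rewrite sqrtr0.
Qed.

(** The approximating simple functions take on each cell of a uniform grid the
    value of [g] at the right end point; the grid points [r_] so chosen tend to
    [t] from the right, and the grid on [0, m + 1] eventually covers [t]. *)
Lemma right_continuous_strongly_measurable T (g : R -> L2 R) :
  (forall t (r_ : nat -> R), 0 < t -> (forall n, t < r_ n) ->
    r_ n @[n --> \oo] --> t -> L2norm (g (r_ n) - g t) @[n --> \oo] --> 0) ->
  strongly_measurable `]0, T[ g.
Proof.
move=> gr.
pose node (m i : nat) : R := i%:R / m.+1%:R.
pose f_ (m : nat) t := \sum_(i < m.+1 * m.+1)
  (\1_(`[node m i, node m i.+1[%classic) t : R) *: g (node m i.+1).
exists f_; split.
  move=> m; exists (m.+1 * m.+1)%N, (fun i => `[node m i, node m i.+1[%classic),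
    (fun i => g (node m i.+1)); split => // i; exact: measurable_itv.
move=> t /=; rewrite in_itv/= => /andP[t0 _].
pose r_ (m : nat) : R := (Num.truncn (t * m.+1%:R)).+1%:R / m.+1%:R.
have m0 (m : nat) : 0 < m.+1%:R :> R by rewrite ltr0Sn.
have tr m : t < r_ m by rewrite /r_ ltr_pdivlMr// truncnS_gt.
have rt m : r_ m <= t + m.+1%:R^-1.
  rewrite /r_ ler_pdivrMr// mulrDl mulVf ?gt_eqF// -natr1 lerD2r.
  by rewrite truncn_le// mulr_ge0// ltW.
have r_t : r_ m @[m --> \oo] --> t.
  apply: (@squeeze_cvgr _ _ _ _ (cst t) (fun m => t + m.+1%:R^-1)).
  - by near=> m; rewrite /= (ltW (tr m)) rt.
  - exact: cvg_cst.
  - rewrite -[X in _ --> X]addr0; apply: cvgD; first exact: cvg_cst.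
    exact: cvg_harmonic.
have := gr t r_ t0 tr r_t; apply: cvg_trans; apply: near_eq_cvg.
near=> m; congr (L2norm (_ - _)); rewrite /f_.
pose i := Num.truncn (t * m.+1%:R).
have im : (i < m.+1 * m.+1)%N.
  rewrite -(ltr_nat R) natrM; apply: le_lt_trans (_ : t * m.+1%:R < _).
    by rewrite /i truncn_le// mulr_ge0// ltW.
  rewrite ltr_pM2r//; apply: (@lt_trans _ _ m%:R); last by rewrite ltr_nat.
  by near: m; exact: nbhs_infty_gtr.
rewrite (bigD1 (Ordinal im))//= big1 ?addr0 => [|j ji].
  rewrite indicE mem_set ?scale1r//= in_itv/= /node; apply/andP; split.
    by rewrite ler_pdivrMr// truncn_le// mulr_ge0// ltW.
  exact: tr.
rewrite indicE memNset ?scale0r//= in_itv/= /node => /andP[h1 h2].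
move/eqP: ji; apply; apply/val_inj => /=; rewrite /i; apply/esym/eqP.
rewrite truncn_eq ?mulr_ge0 ?(ltW t0)//.
by rewrite -ler_pdivrMr// h1 -ltr_pdivlMr.
Unshelve. all: by end_near. Qed.

(** Fubini: the graph of [f] is a planar null set, since its sections over
    the parameter are single points; hence almost all of its other sections, the
    level sets, are null. *)
Lemma ae_level_null (f : R -> R) : measurable_fun [set: measurableTypeR R] f ->
  {ae mu, forall t, leb01 [set s | f s = t] = 0%E}.
Proof.
move=> mf.
pose B : set (measurableTypeR R * measurableTypeR R) := [set z | z.1 - f z.2 = 0].
have mB : measurable B.
  rewrite -[B]setTI.
  have mg : measurable_fun setT (fun z : measurableTypeR R * measurableTypeR R => z.1 - f z.2).
    apply: measurable_funB => //.
    exact: (measurableT_comp mf measurable_snd).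
  by have := mg measurableT [set 0] (measurable_set1 _).
have := indic_fubini_tonelli mu mu mB.
rewrite indic_fubini_tonelli_FE// indic_fubini_tonelli_GE//.
have -> : (\int[mu]_y (mu \o ysection B) y = 0)%E.
  apply: integral0_eq => s _ /=.
  have -> : ysection B s = [set f s].
    apply/seteqP; split => t; rewrite /ysection/= inE /B/=.
      by move/eqP; rewrite subr_eq0 => /eqP.
    by move=> ->; rewrite subrr.
  exact: lebesgue_measure_set1.
move=> h.
have mF : measurable_fun setT (mu \o xsection B) by exact: measurable_fun_xsection.
have : (\int[mu]_x `|(mu \o xsection B) x| = 0)%E.
  by rewrite -h; apply: eq_integral => t _; rewrite gee0_abs.
move=> /(ae_eq_integral_abs _ measurableT mF).
apply: filterS => t /(_ I) /= xB.
have E : xsection B t = [set s | f s = t].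
  apply/seteqP; split => s; rewrite /xsection/= inE /B/=.
    by move/eqP; rewrite subr_eq0 => /eqP.
  by move=> ->; rewrite subrr.
have mL : measurable ([set s | f s = t] : set (measurableTypeR R)).
  by rewrite -E; exact: measurable_xsection.
apply/eqP; rewrite eq_le measure_ge0 andbT -xB E leb01E//.
by apply: le_measure; rewrite ?inE//; exact: measurableI.
Qed.

End L2_convergence.

(** * Weak derivatives of Lipschitz curves *)

Section lipschitz_weak_derivative.
Context {R : realType}.
Notation mu := (@lebesgue_measure R).

Lemma derive0_dini (Z : R -> R) (t : R) : is_derive t 1 Z 0 ->
  forall e, 0 < e -> \forall h \near 0^'+, Z (t + h) <= Z t + e * h.
Proof.
move=> [dZ Z0] e e0.
have /cvgrPdist_le/(_ _ e0) : h^-1 *: (Z (h *: 1 + t) - Z t) @[h --> 0^'] --> (0 : R).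
  by rewrite -[X in _ --> X]Z0; exact: dZ.
rewrite !near_withinE; apply: filterS => h + h0; rewrite gt_eqF// => /(_ isT).
rewrite distrC subr0 /GRing.scale/= mulr1 (addrC h) => /ler_normlW.
by rewrite ler_pdivrMl//; lra.
Qed.

Lemma product_primitive_derive (phi p F : R -> R) (t q : R) :
  derivable phi t 1 -> is_derive t 1 p q -> derivable F t 1 ->
  derive1 F t = derive1 phi t * p t + phi t * q ->
  is_derive t 1 (fun r => phi r * p r - F r) 0.
Proof.
move=> dphi dp dF F't.
have dF' : is_derive t 1 F (derive1 F t).
  by apply: DeriveDef; [exact: dF | rewrite derive1E].
have dphi' : is_derive t 1 phi (derive1 phi t).
  by apply: DeriveDef; [exact: dphi | rewrite derive1E].
have H := is_deriveB (is_deriveM dphi' dp) dF'.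
apply: is_derive_eq H _; rewrite F't /GRing.scale/=; ring.
Qed.

Lemma itv_cst_integral (b : bool) (s t C : R) : s <= t ->
  mu.-integrable [set` Interval (BSide b s) (BRight t)] (EFin \o cst C) /\
  \int[mu]_(r in [set` Interval (BSide b s) (BRight t)]) C = C * (t - s).
Proof.
move=> st.
have E : mu [set` Interval (BSide b s) (BRight t)] = (t - s)%:E.
  rewrite lebesgue_measure_itv/= lte_fin -EFinB; case: ltP => // ts.
  by rewrite (le_anti (introT andP (conj ts st))) subrr.
split.
  apply: measurable_bounded_integrable => //.
    by apply: (@le_lt_trans _ _ (t - s)%:E); [rewrite -E|rewrite ltry].
  by exists `|C|; split => // x Cx t' _ /=; exact: ltW.
rewrite Rintegral_cst//; exact: (congr1 (fun z => C * fine z) E).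
Qed.

(** The function [Z t = phi t * p t - F t], with [F] a primitive of
    [phi' * p + phi * q], is Lipschitz on [0, T], and its derivative vanishes
    almost everywhere by the first fundamental theorem.  Applied to [Z] and to [- Z],
    [dini_noninc] shows that [Z] takes the same value at both ends, where [phi]
    vanishes. *)
Lemma lipschitz_by_parts T (K : R) (p q phi : R -> R) :
  (forall t r, `|p t - p r| <= K * `|t - r|) ->
  (forall t, `|q t| <= K) ->
  measurable_fun (`]0%R, T[%classic : set (measurableTypeR R)) q ->
  {ae mu, forall t : R, 0 < t -> is_derive t 1 p (q t)} ->
  C1c 0 T phi ->
  \int[mu]_(t in `]0, T[) (derive1 phi t * p t) =
  - \int[mu]_(t in `]0, T[) (phi t * q t).
Proof.
move=> plip qK mq pq [dphi cphi' _ supp].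
have [T0|T0] := leP T 0.
  by rewrite set_itv_ge ?bnd_simp -?leNgt// !Rintegral_set0 oppr0.
have phi0 t : ~ (0 < t < T) -> phi t = 0.
  move=> t0T; apply: contrapT => /eqP pt; apply: t0T.
  by have /supp : closure [set t | phi t != 0] t; [exact: subset_closure|rewrite /= in_itv].
have K0 : 0 <= K by apply: le_trans (qK 0).
have [M M0 phi'M] : exists2 M, 0 <= M & forall t, 0 <= t <= T -> `|derive1 phi t| <= M.
  have : compact (derive1 phi @` `[0, T]).
    apply: continuous_compact; last exact: segment_compact.
    exact: continuous_subspaceT.
  move=> /compact_bounded[N [_ hN]]; exists `|N + 1|; first by [].
  move=> t t0T; apply: le_trans (ler_norm _).
  by apply: hN; [rewrite ltrDl | exists t].
have cphi : continuous phi.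
  by move=> t; apply: differentiable_continuous; apply/derivable1_diffP.
have phi_lip t s : 0 <= s -> s <= t -> t <= T -> `|phi t - phi s| <= M * (t - s).
  move=> s0; rewrite le_eqVlt => /predU1P[-> _|st tT].
    by rewrite !subrr normr0 mulr0.
  have [||c] := @MVT _ phi (derive1 phi) s t st.
  - by move=> r _; apply: DeriveDef => //; rewrite derive1E.
  - exact: continuous_subspaceT.
  rewrite in_itv/= => /andP[sc ct] ->.
  rewrite normrM (ger0_norm (_ : 0 <= t - s)); last by rewrite subr_ge0 ltW.
  by rewrite ler_wpM2r ?subr_ge0 ?(ltW st)// phi'M//; apply/andP; split; lra.
pose P := `|p 0| + K * T.
have P0 : 0 <= P by rewrite addr_ge0// mulr_ge0// ltW.
have pP t : 0 <= t <= T -> `|p t| <= P.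
  move=> /andP[t0 tT]; have -> : p t = p 0 + (p t - p 0) by ring.
  apply: le_trans (ler_normD _ _) _; rewrite lerD2l.
  apply: le_trans (plip _ _) _; rewrite subr0 ger0_norm//.
  exact: ler_wpM2l.
have phiM t : 0 <= t <= T -> `|phi t| <= M * T.
  move=> /andP[t0 tT]; have -> : phi t = phi t - phi 0.
    by rewrite (phi0 0) ?subr0// ltxx.
  apply: le_trans (phi_lip _ _ (lexx _) t0 tT) _.
  by rewrite subr0 ler_wpM2l.
pose L := M * P + M * T * K.
have L0 : 0 <= L by rewrite addr_ge0 ?mulr_ge0// ltW.
pose th t := derive1 phi t * p t + phi t * q t.
have cp : continuous p.
  have K1 : 0 < K + 1 by rewrite ltr_wpDl.
  move=> t; apply/cvgrPdist_le => e e0; near=> r.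
  apply: le_trans (plip _ _) _.
  apply: (@le_trans _ _ ((K + 1) * (e / (K + 1)))); last first.
    by rewrite mulrC divfK// gt_eqF.
  apply: ler_pM => //; first by rewrite lerDl.
  near: r; apply: cvgr_dist_le; first exact: cvg_id.
  by rewrite divr_gt0.
pose D : set (measurableTypeR R) := `]0, T[%classic.
have mD : measurable D by exact: measurable_itv.
have m1 : measurable_fun D (fun t => derive1 phi t * p t).
  apply: measurable_funTS; apply: measurable_funM.
    exact: continuous_measurable_fun.
  exact: continuous_measurable_fun.
have m2 : measurable_fun D (fun t => phi t * q t).
  apply: measurable_funM => //; apply: measurable_funTS.
  exact: continuous_measurable_fun.
have b1 t : 0 < t < T -> `|derive1 phi t * p t| <= M * P.
  move=> /andP[t0 tT]; rewrite normrM ler_pM//.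
    by rewrite phi'M// !ltW.
  by rewrite pP// !ltW.
have b2 t : 0 < t < T -> `|phi t * q t| <= M * T * K.
  by move=> /andP[t0 tT]; rewrite normrM ler_pM// phiM// !ltW.
have bounded_int (f : R -> R) (C : R) : measurable_fun D f ->
    (forall t, 0 < t < T -> `|f t| <= C) -> mu.-integrable D (EFin \o f).
  move=> mf fC; apply: measurable_bounded_integrable => //.
    apply: (@le_lt_trans _ _ T%:E); last by rewrite ltry.
    have : (mu `]0%R, T[ <= T%:E)%E.
      by rewrite lebesgue_measure_itv/= lte_fin T0 oppr0 adde0.
    exact.
  exists C; split; first exact: num_real.
  move=> x Cx t /=; rewrite /D/= in_itv/= => t0T.
  exact: le_trans (fC t t0T) (ltW Cx).
have i1 := bounded_int _ _ m1 b1.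
have i2 := bounded_int _ _ m2 b2.
have ith : mu.-integrable D (EFin \o th) by exact: EFin_integrableD.
pose ths := th \_ D.
have iths : mu.-integrable setT (EFin \o ths).
  by rewrite -restrict_EFin; apply/(integrable_mkcond _ _).1.
have thsL t : `|ths t| <= L.
  rewrite /ths patchE; case: ifPn => [|_]; last by rewrite normr0.
  rewrite inE /D/= in_itv/= => t0T.
  apply: le_trans (ler_normD _ _) _; apply: lerD; first exact: b1.
  exact: b2.
pose F t := \int[mu]_(r in `[0, t]) ths r.
have FD s t : 0 <= s -> s <= t -> `|F t - F s| <= L * (t - s).
  move=> s0 st.
  rewrite /F (@Rintegral_itvB _ _ (BLeft 0) (BRight t) s)//.
  - have is_ : mu.-integrable `]s, t] (EFin \o ths) by exact: integrableS iths.
    apply: le_trans (le_normr_Rintegral _ is_) _ => //.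
    apply: (@le_trans _ _ (\int[mu]_(r in `]s, t]) L)).
      apply: le_Rintegral => //; first exact: integrable_norm.
      by have [] := @itv_cst_integral false s t L st.
    by have [_ ->] := @itv_cst_integral false s t L st.
  - exact: integrableS iths.
pose Z t := phi t * p t - F t.
have Z_lip s t : 0 <= s -> s <= t -> t <= T -> `|Z t - Z s| <= 2 * L * (t - s).
  move=> s0 st tT.
  have -> : Z t - Z s = (phi t * (p t - p s) + p s * (phi t - phi s)) - (F t - F s).
    by rewrite /Z; ring.
  apply: le_trans (ler_normB _ _) _.
  have := FD s t s0 st; have := ler_normD (phi t * (p t - p s)) (p s * (phi t - phi s)).
  rewrite !normrM.
  have h1 : `|phi t| * `|p t - p s| <= M * T * (K * (t - s)).
    apply: ler_pM => //; first by rewrite phiM// (le_trans s0).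
    by apply: le_trans (plip _ _) _; rewrite ger0_norm// subr_ge0.
  have h2 : `|p s| * `|phi t - phi s| <= P * (M * (t - s)).
    apply: ler_pM => //; first by rewrite pP// s0 (le_trans st).
    exact: phi_lip.
  rewrite /L; lra.
have Z_der : {ae mu, forall t : R, 0 < t < T -> is_derive t 1 Z 0}.
  have ith' y : mu.-integrable [set` Interval (BLeft 0) (BRight y)] (EFin \o ths).
    exact: integrableS iths.
  have := FTC1 ith' (open_integrable_locally openT iths).
  move: pq; apply: filterS2; first exact: (ae_filter_ringOfSetsType mu).
  move=> t pqt Ft /andP[t0 tT]; have [dF F't] : derivable F t 1 /\ derive1 F t = ths t.
    by apply: Ft; rewrite /= lte_fin.
  apply: (product_primitive_derive (dphi t) (pqt t0) dF).
  by rewrite F't /ths patchE mem_set// /D/= in_itv/= t0.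
have Zint (Y : R -> R) : (forall s t, 0 <= s -> s <= t -> t <= T -> Y t - Y s <= 2 * L * (t - s)) ->
    {ae mu, forall t : R, 0 < t < T -> is_derive t 1 Y 0} -> Y T <= Y 0.
  move=> Ylip Yder.
  apply: (@dini_noninc _ 0 T Y (cst (2 * L))); first exact: ltW.
  - by have [] := @itv_cst_integral true 0 T (2 * L) (ltW T0).
  - by move=> t; rewrite mulr_ge0.
  - move=> s t s0 st tT; have [_ ->] := @itv_cst_integral true s t (2 * L) st.
    exact: Ylip.
  - move: Yder; apply: filterS; first exact: (ae_filter_ringOfSetsType mu).
    by move=> t Yt t0T; apply: derive0_dini; exact: Yt.
have ZT : Z T = Z 0.
  apply/eqP; rewrite eq_le; apply/andP; split.
    apply: Zint => // s t s0 st tT; apply: le_trans (Z_lip s t s0 st tT).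
    exact: ler_norm.
  rewrite -lerN2; apply: (Zint (fun t => - Z t)) => [s t s0 st tT|].
    apply: le_trans (Z_lip s t s0 st tT); rewrite -normrN.
    by rewrite -[leLHS]opprD; exact: ler_norm.
  move: Z_der; apply: filterS; first exact: (ae_filter_ringOfSetsType mu).
  by move=> t /[apply] Zt; rewrite -oppr0; exact: is_deriveN.
have F0 : F 0 = 0 by rewrite /F set_itv1 Rintegral_set1.
have FT : F T = \int[mu]_(t in D) th t.
  rewrite /F [LHS]Rintegral_mkcond [RHS]Rintegral_mkcond; apply: eq_Rintegral => t _.
  rewrite /ths !patchE; case: ifPn => //; rewrite notin_setE/= => tT.
  by rewrite memNset// => tD; apply: tT; exact: subset_itv_oo_cc tD.
move: ZT; rewrite /Z F0 FT phi0 ?ltxx ?andbF// phi0 ?ltxx// !mul0r subr0 sub0r.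
rewrite /th RintegralD// => /eqP; rewrite oppr_eq0 addr_eq0 => /eqP; exact.
Unshelve. all: by end_near. Qed.

End lipschitz_weak_derivative.

Section lipschitz_curve.
Context {R : realType}.
Notation mu := (@lebesgue_measure R).
Implicit Types (g f : R -> L2 R).

Lemma strong_derive_dot g t (v z : L2 R) : is_strong_derive g t v ->
  is_derive (t : R) 1 (fun r => L2dot (g r) z) (L2dot v z).
Proof.
move=> gv.
have H : h^-1 *: (L2dot (g (h *: 1 + t)) z - L2dot (g t) z) @[h --> 0^'] --> L2dot v z.
  apply/cvgrPdist_le => e e0; have [d d0 hd] := L2dot_small z e0.
  have /cvgrPdist_le/(_ _ d0) := gv; apply: filterS => h.
  rewrite distrC subr0 ger0_norm ?L2norm_ge0// /GRing.scale/= mulr1 (addrC h) => hh.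
  by rewrite distrC -L2dotBl -[_ * L2dot _ _]L2dotZl -L2dotBl hd.
split; first by apply/cvg_ex; exists (L2dot v z).
exact: cvg_lim H.
Qed.

(** Weak derivatives are tested against fixed vectors, hence the scalar case is
    enough. *)
Lemma lipschitz_weak_derivative T K g f :
  (forall t r, L2norm (g t - g r) <= K * `|t - r|) ->
  (forall t, L2norm (f t) <= K) ->
  strongly_measurable `]0, T[ f ->
  {ae mu, forall t, 0 < t -> is_strong_derive g t (f t)} ->
  weak_derivative 0 T g f.
Proof.
move=> glip fK mf gf phi z C.
apply: (@lipschitz_by_parts _ T (K * L2norm z) (fun t => L2dot (g t) z)
  (fun t => L2dot (f t) z) phi) => //.
- move=> t r; rewrite -L2dotBl; apply: le_trans (L2dot_norm _ _) _.
  by rewrite mulrAC ler_wpM2r ?L2norm_ge0.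
- move=> t; apply: le_trans (L2dot_norm _ _) _.
  by rewrite ler_wpM2r ?L2norm_ge0.
- exact: strongly_measurable_dot.
- move: gf; apply: filterS; first exact: (ae_filter_ringOfSetsType mu).
  by move=> t gt t0; apply: strong_derive_dot; exact: gt.
Qed.

Lemma bounded_bochner_L1 a b K f : strongly_measurable `]a, b[ f ->
  (forall t, a < t < b -> L2norm (f t) <= K) -> bochner_L1 `]a, b[ f.
Proof.
move=> mf fK; split => //.
have mn : measurable_fun `]a, b[ (EFin \o (fun t => L2norm (f t))).
  by apply/measurable_EFinP; exact: strongly_measurable_norm.
apply: (@le_lt_trans _ _ (\int[mu]_(t in `]a, b[) (cst `|K|%:E t))%E).
  apply: ge0_le_integral => //.
  - by move=> t _; rewrite lee_fin L2norm_ge0.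
  - move=> t; rewrite /= in_itv/= => tab; rewrite lee_fin.
    by apply: le_trans (fK _ tab) _; exact: ler_norm.
rewrite integral_cst// lte_mul_pinfty// ?lee_fin//.
have : (mu `]a, b[ < +oo)%E.
  by rewrite lebesgue_measure_itv/=; case: ifP => _; rewrite -?EFinB ltry.
exact.
Qed.

End lipschitz_curve.

(** * Measurable dependence on the particle *)

Section cells.
Context {R : realType}.

Lemma measurable_inv : measurable_fun [set: R] (@GRing.inv R).
Proof.
have -> : [set: R] = [set 0] `|` [set~ 0].
  by rewrite setUv.
apply/measurable_funU.
- exact: measurable_set1.
- by apply: measurableC; exact: measurable_set1.
split; first exact: measurable_fun_set1.
apply: open_continuous_measurable_fun.
  by apply: closed_openC; exact: closed_eq.
by move=> y; rewrite inE/= => /eqP y0; exact: inv_continuous.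
Qed.

(** This is how the integer-valued indices of the explicit solution are handled:
    on each of their level sets one fixed formula applies. *)
Lemma measurable_fun_param (C : countType) (D : set (measurableTypeR R))
    (c : R -> C) (F : C -> R -> R) :
  (forall i, measurable (D `&` [set s | c s = i])) ->
  (forall i, measurable_fun D (F i)) ->
  measurable_fun D (fun s => F (c s) s).
Proof.
move=> mc mF mD Y mY.
have -> : D `&` (fun s => F (c s) s) @^-1` Y =
    \bigcup_i ((D `&` [set s | c s = i]) `&` (D `&` F i @^-1` Y)).
  apply/seteqP; split => s.
    by move=> [Ds Ys]; exists (c s).
  by move=> [i _ [[Ds <-] [_ Ys]]].
apply: countable_bigcupT_measurable => [|i]; first exact: countableP.
by apply: measurableI; [exact: mc | exact: mF].
Qed.

Variables (n : nat) (x w : nat -> R).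
Hypothesis hw : forall j, (1 <= j <= n)%N -> 0 < w j <= 1.
Hypothesis hw1 : \sum_(1 <= j < n.+1) w j = 1.
Hypothesis hx : forall j, (1 <= j < n)%N -> x j < x j.+1.
Variable q0 : R -> R.
Hypothesis mq0 : measurable_fun [set: measurableTypeR R] q0.
Local Notation W := (cumw w).
Let D : set (measurableTypeR R) := [set s | regular n w s].
Let q1 s := x (ell n w s).

Lemma measurable_regular : measurable D.
Proof.
have -> : D = `]0%R, 1%R[%classic `&`
    \bigcap_k (if (1 <= k < n)%N then ~` [set W k] else setT).
  apply/seteqP; split => s /=; rewrite in_itv/= => -[s01 sW]; split => //.
    by move=> k _; case: ifPn => // /sW.
  by move=> k kn; have := sW k I; rewrite kn.
apply: measurableI => //; apply: bigcapT_measurable => k.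
by case: ifPn => _ //; apply: measurableC; exact: measurable_set1.
Qed.

Lemma ell_uniq s i : regular n w s -> (1 <= i <= n)%N ->
  W i.-1 < s < W i -> ell n w s = i.
Proof.
move=> rs /andP[i1 in_] /andP[h1 h2].
have [/andP[l1 ln] /andP[sl sr]] := ell_spec hw1 rs.
apply/eqP; rewrite eqn_leq; apply/andP; split; rewrite leqNgt; apply/negP => h.
  have : W i <= W (ell n w s).-1 by apply: (cumw_le hw); lia.
  by lra.
have : W (ell n w s) <= W i.-1 by apply: (cumw_le hw); lia.
by lra.
Qed.

Lemma measurable_ell i : measurable (D `&` [set s | ell n w s = i]).
Proof.
have -> : D `&` [set s | ell n w s = i] =
    D `&` (if (1 <= i <= n)%N then `]W i.-1, W i[%classic else set0).
  apply/seteqP; split => s [rs] /=.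
    move=> <-; split => //; have [-> h] := ell_spec hw1 rs.
    by rewrite /= in_itv.
  case: ifPn => // i1; rewrite /= in_itv/= => h; split => //.
  exact: ell_uniq.
by apply: measurableI; [exact: measurable_regular | case: ifPn].
Qed.

Lemma measurable_q1 : measurable_fun D q1.
Proof.
apply: (@measurable_fun_param nat D (ell n w) (fun i _ => x i)) => [i|i].
  exact: measurable_ell.
exact: measurable_cst.
Qed.

Lemma xbar_le i j : (i <= j)%N -> (xbar n x i <= xbar n x j)%E.
Proof.
move=> ij; rewrite /xbar; case: i ij => [|i] ij /=; first exact: leNye.
case: j ij => [//|j] ij /=; case: (ltnP j n) => jn; last exact: leey.
by rewrite (leq_trans ij)// lee_fin (x_le hx).
Qed.

(** [kidx] is characterized by the interval of the partition
    [x_0, ..., x_(n+1)] that contains [q0 s], half-open on the side that depends on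
    the direction of motion. *)
Lemma measurable_kidx i : measurable (D `&` [set s | kidx n x (q0 s) (q1 s) = i]).
Proof.
pose B : set (measurableTypeR R) := D `&` [set s | q0 s <= q1 s].
have mq0D : measurable_fun D q0 by exact: measurable_funTS.
have mB : measurable B.
  rewrite /B; have := measurable_fun_ler mq0D measurable_q1 measurable_regular.
  by move=> /(_ [set true]); apply.
pose U : set (measurableTypeR R) := if (i <= n)%N then
  (fun s => (q0 s)%:E) @^-1` `[xbar n x i, xbar n x i.+1[%classic else set0.
pose L : set (measurableTypeR R) := if (1 <= i <= n.+1)%N then
  (fun s => (q0 s)%:E) @^-1` `]xbar n x i.-1, xbar n x i]%classic else set0.
have mqi (I : interval (\bar R)) :
    measurable ((fun s => (q0 s)%:E) @^-1` [set` I] : set (measurableTypeR R)).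
  rewrite -[X in measurable X]setTI.
  have mE : measurable_fun [set: measurableTypeR R] (EFin \o q0).
    exact/measurable_EFinP.
  by apply: mE => //; exact: emeasurable_itv.
have -> : D `&` [set s | kidx n x (q0 s) (q1 s) = i] = (B `&` U) `|` ((D `\` B) `&` L).
  apply/seteqP; split => s.
    move=> [rs /= ki]; rewrite /U /L -ki {U L}; have [q01|q10] := leP (q0 s) (q1 s).
      left; split => //; have [-> /= h] := kidx_up n x q01.
      by rewrite in_itv.
    right; split.
      by split => // -[_ /=]; rewrite leNgt q10.
    by have [-> /= h] := kidx_down n x q10; rewrite in_itv.
  move=> [[[rs q01]]|[[rs nB]]].
    rewrite /U; case: ifPn => // in_; rewrite /= in_itv/= => /andP[h1 h2].
    split => //=; have [kn /andP[k1 k2]] := kidx_up n x q01.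
    apply/eqP; rewrite eqn_leq; apply/andP; split; rewrite leqNgt; apply/negP => h.
      by have := lt_le_trans h2 (le_trans (xbar_le h) k1); rewrite ltxx.
    by have := lt_le_trans k2 (le_trans (xbar_le h) h1); rewrite ltxx.
  rewrite /L; case: ifPn => // /andP[i1 in_]; rewrite /= in_itv/= => /andP[h1 h2].
  have q10 : q1 s < q0 s by rewrite ltNge; apply/negP => q01; apply: nB.
  split => //=; have [/andP[k0 kn] /andP[k1 k2]] := kidx_down n x q10.
  apply/eqP; rewrite eqn_leq; apply/andP; split; rewrite leqNgt; apply/negP => h.
    have /xbar_le h' : (i <= (kidx n x (q0 s) (q1 s)).-1)%N by rewrite -ltnS prednK.
    by have := lt_le_trans k1 (le_trans h2 h'); rewrite ltxx.
  have /xbar_le h' : (kidx n x (q0 s) (q1 s) <= i.-1)%N by rewrite -ltnS prednK.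
  by have := lt_le_trans h1 (le_trans k2 h'); rewrite ltxx.
apply: measurableU; apply: measurableI.
- exact: mB.
- by rewrite /U; case: ifPn.
- by apply: measurableD => //; exact: measurable_regular.
- by rewrite /L; case: ifPn.
Qed.

(** The discrete data of a particle, through which [xstep], [Rstep] and [nsteps]
    factor. *)
Let code s : nat * nat * bool :=
  (kidx n x (q0 s) (q1 s), ell n w s, q0 s <= q1 s).

Lemma measurable_code (H : nat * nat * bool -> R) :
  measurable_fun D (fun s => H (code s)).
Proof.
apply: (@measurable_fun_param _ D code (fun c _ => H c)) => [[[k l] b]|c]; last exact: measurable_cst.
have -> : D `&` [set s | code s = (k, l, b)] =
    (D `&` [set s | kidx n x (q0 s) (q1 s) = k]) `&`
    ((D `&` [set s | ell n w s = l]) `&` (D `&` [set s | (q0 s <= q1 s) = b])).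
  apply/seteqP; split => s; first by move=> [rs [/= <- <- <-]].
  by move=> [[rs h1] [[_ h2] [_ h3]]]; split => //; move: h1 h2 h3; rewrite /code/= => -> -> ->.
apply: measurableI; first exact: measurable_kidx.
apply: measurableI; first exact: measurable_ell.
have mq0D : measurable_fun D q0 by exact: measurable_funTS.
by have /(_ [set b]) := measurable_fun_ler mq0D measurable_q1 measurable_regular; apply.
Qed.

Lemma measurable_nsteps i :
  measurable (D `&` [set s | nsteps n x w (q0 s) (q1 s) s = i]).
Proof.
have := measurable_code (fun c => (`|(c.1.2)%:Z - (c.1.1)%:Z|%N)%:R).
move=> /(_ measurable_regular [set i%:R] (measurable_set1 _)).
congr (measurable (_ `&` _)); apply/seteqP; split => s /=.
  by move=> /eqP; rewrite eqr_nat => /eqP.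
by rewrite /nsteps => ->.
Qed.

Lemma measurable_node j : measurable_fun D (fun s => node n x w (q0 s) s j).
Proof.
rewrite /node; case: j => [|j] /=; first exact: measurable_funTS.
exact: (measurable_code (fun c => if c.2 then x (c.1.1 + j.+1)%N else x (c.1.1 - j.+1)%N)).
Qed.

Lemma measurable_speed j : measurable_fun D (fun s => speed n x w (q0 s) s j).
Proof.
apply: measurable_funM => //; apply: measurable_funB => //.
exact: (measurable_code (fun c => if c.2 then W (c.1.1 + j)%N else W (c.1.1 - j - 1)%N)).
Qed.

Lemma measurable_tstep j :
  measurable_fun D (fun s => tstep n x w (q0 s) (q1 s) s j).
Proof.
elim: j => [|j IH]; first exact: measurable_cst.
under eq_fun do rewrite tstepS.
apply: measurable_funD => //; apply: measurable_funM.
  by apply: measurable_funB; exact: measurable_node.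
apply: (@measurableT_comp _ _ _ _ _ _ (@GRing.inv R)); last exact: measurable_speed.
exact: measurable_inv.
Qed.

End cells.

(** * The flow of the initial quantile function *)

Section flow.
Context {R : realType}.
Notation mu := (@lebesgue_measure R).
Variables (n : nat) (x w : nat -> R).
Hypothesis hw : forall j, (1 <= j <= n)%N -> 0 < w j <= 1.
Hypothesis hw1 : \sum_(1 <= j < n.+1) w j = 1.
Hypothesis hx : forall j, (1 <= j < n)%N -> x j < x j.+1.
Variable u0 : L2 R.
Let D : set (measurableTypeR R) := [set s | regular n w s].
Let N s := nsteps n x w (u0 s) (x (ell n w s)) s.
Let ts s := tstep n x w (u0 s) (x (ell n w s)) s.
Let sp s := speed n x w (u0 s) s.

Let measurable_u0 : measurable_fun [set: measurableTypeR R] u0.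
Proof. exact: measurable_L2. Qed.

Lemma ae_regular : {ae leb01, forall s, regular n w s}.
Proof.
have : {ae leb01, forall s, forall k, s <> cumw w k}.
  apply/ae_foralln => k; exists [set cumw w k]; split.
  - exact: measurable_set1.
  - apply/eqP; rewrite eq_le measure_ge0 andbT leb01E; last exact: measurable_set1.
    rewrite -(lebesgue_measure_set1 (cumw w k)).
    apply: le_measure; rewrite ?inE; [|exact: measurable_set1|by move=> s []].
    by apply: measurableI; [exact: measurable_set1|exact: measurable_itv].
  - by move=> s /= /contrapT.
have := @ae_leb01 R; apply: filterS2; first exact: (ae_filter_ringOfSetsType leb01).
by move=> s s01 sW; split => // k _; exact: sW.
Qed.

Lemma ae_regularW (P : R -> Prop) :
  (forall s, regular n w s -> P s) -> {ae leb01, forall s, P s}.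
Proof.
move=> rP; have := ae_regular; apply: filterS; first exact: (ae_filter_ringOfSetsType leb01).
exact: rP.
Qed.

(** Off the regular parameters, which exhaust (0,1) up to finitely many points,
    the value is the irrelevant 0. *)
Definition flow_fun (t : R) : R -> R :=
  (fun s => pl_pos (N s) (u0 s) (sp s) (ts s) t) \_ D.

Definition flow_vel_fun (t : R) : R -> R :=
  (fun s => pl_vel (N s) (sp s) (ts s) t) \_ D.

Lemma measurable_flow_fun t : measurable_fun [set: measurableTypeR R] (flow_fun t).
Proof.
apply/(measurable_restrictT _ (measurable_regular n w)).
apply: (@measurable_fun_param _ nat D N (fun i s => pl_pos i (u0 s) (sp s) (ts s) t)).
  exact: (measurable_nsteps hw hw1 hx measurable_u0).
move=> i; apply: measurable_funD; first exact: measurable_funTS.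
apply: measurable_sum => j; apply: measurable_funM; first exact: measurable_speed.
by apply: measurable_funB; apply: measurable_minr => //; exact: measurable_tstep.
Qed.

Lemma measurable_flow_vel_fun t :
  measurable_fun [set: measurableTypeR R] (flow_vel_fun t).
Proof.
apply/(measurable_restrictT _ (measurable_regular n w)).
apply: (@measurable_fun_param _ nat D N (fun i s => pl_vel i (sp s) (ts s) t)).
  exact: (measurable_nsteps hw hw1 hx measurable_u0).
have mlt j : measurable_fun D (fun s => (t < ts s j)%R%:R : R).
  apply: (@measurable_fun_param _ bool D (fun s => t < ts s j) (fun b _ => b%:R)) => //.
  move=> b; have mt : measurable_fun D (fun s => ts s j) by exact: measurable_tstep.
  have /(_ [set b]) := measurable_fun_ltr (measurable_cst t) mt (measurable_regular n w).
  exact.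
move=> i; apply: measurable_sum => j; apply: measurable_funM; first exact: measurable_speed.
exact: measurable_funB.
Qed.

Lemma flow_start s : regular n w s -> pl_pos (N s) (u0 s) (sp s) (ts s) 0 = u0 s.
Proof.
move=> rs; rewrite /pl_pos big1 ?addr0// => j _.
have t0 i : (i <= N s)%N -> 0 <= ts s i.
  apply: (@ts_ge0 _ (N s) (node n x w (u0 s) s) (sp s) (ts s)) => //.
    by move=> k _; exact: tstepS.
  exact: motion_dts.
by rewrite (min_l (t0 _ (ltn_ord j))) (min_l (t0 _ (ltnW (ltn_ord j)))) subrr mulr0.
Qed.

Lemma flow_fun_le t s : `|flow_fun t s| <= `|u0 s| + 2 * `|t|.
Proof.
rewrite /flow_fun patchE; case: ifPn => [/set_mem rs|_].
  have := motion_lipschitz hw hw1 hx (u0 s) rs t 0.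
  rewrite subr0 -/(N s) -/(ts s) -/(sp s) flow_start// => h.
  rewrite -lerBlDl; apply: le_trans h; exact: lerB_dist.
by rewrite normr0 addr_ge0// mulr_ge0.
Qed.

Lemma flow_vel_fun_le t s : `|flow_vel_fun t s| <= 2.
Proof.
rewrite /flow_vel_fun patchE; case: ifPn => [/set_mem rs|_].
  exact: motion_vel_bound.
by rewrite normr0.
Qed.

Lemma flow_L2 t : flow_fun t \in Lfun leb01 2%:E.
Proof. by apply: L2_mem_le (flow_fun_le t); exact: measurable_flow_fun. Qed.

Lemma flow_vel_L2 t : flow_vel_fun t \in Lfun leb01 2%:E.
Proof.
apply: (@L2_mem_le _ _ (0 : L2 R) 2); first exact: measurable_flow_vel_fun.
by move=> s; rewrite (le_trans (flow_vel_fun_le t s))// lerDr.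
Qed.

Definition flow t : L2 R := Lfun_Sub (lee1n 2) (flow_L2 t).
Definition flow_vel t : L2 R := Lfun_Sub (lee1n 2) (flow_vel_L2 t).

Lemma flowE t s : regular n w s -> flow t s = pl_pos (N s) (u0 s) (sp s) (ts s) t.
Proof. by move=> rs; rewrite /flow/= /flow_fun patchE mem_set. Qed.

Lemma flow_velE t s : regular n w s -> flow_vel t s = pl_vel (N s) (sp s) (ts s) t.
Proof. by move=> rs; rewrite /flow_vel/= /flow_vel_fun patchE mem_set. Qed.

Lemma flow_lipschitz t r : L2norm (flow t - flow r) <= 2 * `|t - r|.
Proof.
apply: L2norm_le; first by rewrite mulr_ge0.
apply: ae_regularW => s rs; rewrite !L2E !flowE//.
exact: motion_lipschitz.
Qed.

Lemma flow_vel_bound t : L2norm (flow_vel t) <= 2.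
Proof.
apply: L2norm_le => //; apply: ae_regularW => s rs; rewrite flow_velE//.
exact: motion_vel_bound.
Qed.

Lemma flow_strongly_measurable T : strongly_measurable `]0, T[ flow.
Proof.
apply: right_continuous_strongly_measurable => t r_ _ _ rt.
apply: (@squeeze_cvgr _ _ _ _ (cst 0) (fun m => 2 * `|r_ m - t|)).
- by near=> m; rewrite /= L2norm_ge0 flow_lipschitz.
- exact: cvg_cst.
- rewrite -[X in _ --> X](mulr0 2); apply: cvgMr.
  rewrite -(normr0 R); apply: cvg_norm; rewrite -(subrr t).
  by apply: cvgB => //; exact: cvg_cst.
Unshelve. all: by end_near. Qed.

(** The velocity of each particle is right continuous, and dominated convergence
    carries this over to L_2(0,1). *)
Lemma flow_vel_strongly_measurable T : strongly_measurable `]0, T[ flow_vel.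
Proof.
apply: right_continuous_strongly_measurable => t r_ _ tr rt.
apply: (@L2_dominated _ _ 4) => [m|].
  apply: ae_regularW => s rs; rewrite !L2E !flow_velE//.
  apply: le_trans (ler_normB _ _) _.
  have := motion_vel_bound hw hw1 hx (u0 s) rs t.
  have := motion_vel_bound hw hw1 hx (u0 s) rs (r_ m).
  rewrite /N /sp /ts; set a := `|_|; set b := `|_|; move: a b => a b; lra.
apply: ae_regularW => s rs.
have -> : (fun m => (flow_vel (r_ m) - flow_vel t) s) =
    (fun m => pl_vel (N s) (sp s) (ts s) (r_ m) - pl_vel (N s) (sp s) (ts s) t).
  by apply/funext => m; rewrite !L2E !flow_velE.
apply/subr_cvg0.
have /cvg_at_rightP := @pl_vel_right_cont _ (N s) (sp s) (ts s) t.
by apply.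
Qed.

(** At a fixed time only the particles that meet a node at that time can fail to
    have a derivative, and by [ae_level_null] they form a null set for almost
    every time.  The difference quotients are bounded by the Lipschitz constant 2,
    so dominated convergence applies along sequences of increments. *)
Lemma flow_strong_derive : {ae mu, forall t, is_strong_derive flow t (flow_vel t)}.
Proof.
pose tau j : R -> R := (ts ^~ j) \_ D.
have mtau j : measurable_fun [set: measurableTypeR R] (tau j).
  apply/(measurable_restrictT _ (measurable_regular n w)).
  exact: measurable_tstep.
have : {ae mu, forall t, forall j, leb01 [set s | tau j s = t] = 0%E}.
  by apply/ae_foralln => j; exact: ae_level_null.
apply: filterS; first exact: (ae_filter_ringOfSetsType mu).
move=> t tau0.
have nodes : {ae leb01, forall s, forall j, tau j s <> t}.
  apply/ae_foralln => j; exists [set s | tau j s = t]; split.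
  - by rewrite -[X in measurable X]setTI; exact: (mtau j measurableT _ (measurable_set1 t)).
  - exact: tau0.
  - by move=> s /= /contrapT.
rewrite /is_strong_derive; apply/cvgr_dnbhsP => h_ [h0 hh].
apply: (@L2_dominated _ _ 4) => [m|].
  apply: ae_regularW => s rs; rewrite !L2E !flowE// flow_velE//.
  apply: le_trans (ler_normB _ _) _.
  have := motion_vel_bound hw hw1 hx (u0 s) rs t.
  have := motion_lipschitz hw hw1 hx (u0 s) rs (t + h_ m) t.
  rewrite -/(N s) -/(sp s) -/(ts s) (addrC t) addrK normrM normfV => hl hv.
  have : `|h_ m|^-1 * `|pl_pos (N s) (u0 s) (sp s) (ts s) (h_ m + t) -
      pl_pos (N s) (u0 s) (sp s) (ts s) t| <= 2.
    by rewrite mulrC ler_pdivrMr// normr_gt0.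
  move: hv; set a := `|_|; set b := _^-1 * _; move: a b => a b; lra.
move: nodes; apply: filterS2 ae_regular; first exact: (ae_filter_ringOfSetsType leb01).
move=> s rs st.
have -> : (fun m => ((h_ m)^-1 *: (flow (t + h_ m) - flow t) - flow_vel t) s) =
    (fun m => (h_ m)^-1 * (pl_pos (N s) (u0 s) (sp s) (ts s) (t + h_ m) -
      pl_pos (N s) (u0 s) (sp s) (ts s) t) - pl_vel (N s) (sp s) (ts s) t).
  by apply/funext => m; rewrite !L2E !flowE// flow_velE.
apply/subr_cvg0.
have tts j : (j <= N s)%N -> t != ts s j.
  by move=> _; apply/eqP => tj; apply: (st j); rewrite /tau patchE mem_set.
have /cvgr_dnbhsP/(_ h_) := pl_pos_derive (u0 s) (vs:=sp s) tts.
by apply.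
Qed.

Lemma flow_W11 T : 0 < T -> W11 T flow.
Proof.
move=> T0; split.
  apply: (@bounded_bochner_L1 _ _ _ (L2norm (flow 0) + 2 * T)).
    exact: flow_strongly_measurable.
  move=> t /andP[t0 tT].
  have -> : flow t = flow 0 + (flow t - flow 0) by rewrite addrC subrK.
  apply: le_trans (ler_L2normD _ _) _; rewrite lerD2l.
  apply: le_trans (flow_lipschitz _ _) _.
  by rewrite subr0 (gtr0_norm t0) ler_pM2l// ltW.
exists flow_vel; split.
  move=> d /andP[d0 dT]; apply: (@bounded_bochner_L1 _ _ _ 2) => [|t _].
    have [f_ [fs ft]] := flow_vel_strongly_measurable T.
    exists f_; split => // t; rewrite /= in_itv/= => /andP[dt tT]; apply: ft.
    by rewrite /= in_itv/= tT (lt_trans d0).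
  exact: flow_vel_bound.
apply: (@lipschitz_weak_derivative _ _ 2).
- exact: flow_lipschitz.
- exact: flow_vel_bound.
- exact: flow_vel_strongly_measurable.
- have := flow_strong_derive.
  by apply: filterS; first exact: (ae_filter_ringOfSetsType mu).
Qed.

Lemma flow_continuous : continuous_L2 flow.
Proof.
move=> t _; apply: cvg_within_filter.
apply: (@squeeze_cvgr _ _ _ _ (cst 0) (fun r => 2 * `|r - t|)).
- by near=> r; rewrite /= L2norm_ge0 flow_lipschitz.
- exact: cvg_cst.
- rewrite -[X in _ --> X](mulr0 2); apply: cvgMr.
  rewrite -(normr0 R); apply: cvg_norm; rewrite -(subrr t).
  by apply: cvgB; [exact: cvg_id | exact: cvg_cst].
Unshelve. all: by end_near. Qed.

Variable nu : probability (measurableTypeR R) R.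
Hypothesis hnu : forall A : set (measurableTypeR R), measurable A ->
  nu A = (\sum_(1 <= j < n.+1) (w j)%:E * \d_(x j) A)%E.

Lemma flow_strong_solution : strong_solution (Fnu nu) u0 flow.
Proof.
split.
- exact: flow_W11.
- exact: flow_continuous.
- by apply: ae_regularW => s rs; rewrite flowE// flow_start.
- have := flow_strong_derive; apply: filterS; first exact: (ae_filter_ringOfSetsType mu).
  move=> t ft t0; exists (flow_vel t) => //.
  apply: (subdiff_Fnu hw hnu); apply: ae_regularW => s rs y'.
  rewrite !L2E flowE// flow_velE// mulNr.
  exact: (motion_subgrad hw hw1 hx (u0 s) rs y' (ltW t0)).
Qed.

Lemma flow_explicit s : regular n w s ->
  explicit_trajectory n x w (u0 s) (quantile nu s) s (fun t => flow t s).
Proof.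
move=> rs; rewrite (quantile_nu hw hw1 hx hnu rs).
have -> : (fun t => flow t s) = pl_pos (N s) (u0 s) (sp s) (ts s).
  by apply/funext => t; rewrite flowE.
exact: motion_explicit.
Qed.

End flow.

Theorem corollary5p3 (R : realType)
  (mu0 nu : probability (measurableTypeR R) R)
  (n : nat) (x w : nat -> R)
  (hmu0 : finite_second_moment mu0)
  (hw : forall j, (1 <= j <= n)%N -> 0 < w j <= 1)
  (hw1 : \sum_(1 <= j < n.+1) w j = 1)
  (hx : forall j, (1 <= j < n)%N -> x j < x j.+1)
  (hnu : forall A : set (measurableTypeR R), measurable A ->
     nu A = (\sum_(1 <= j < n.+1) (w j)%:E * \d_(x j) A)%E) :
  exists g : R -> L2 R,
    [/\ strong_solution (Fnu nu) (quantile mu0) g,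
        (forall h : R -> L2 R, strong_solution (Fnu nu) (quantile mu0) h ->
           forall t, 0 <= t -> {ae leb01, forall s, h t s = g t s}) &
        (forall s : R, 0 < s < 1 ->
           (forall k, (1 <= k < n)%N -> s <> cumw w k) ->
           explicit_trajectory n x w (quantile mu0 s) (quantile nu s) s
             (fun t => g t s))].
Proof.
pose u0 : L2 R := Lfun_Sub (lee1n 2) (quantile_L2 hmu0).
exists (flow hw hw1 hx u0).
have sol : strong_solution (Fnu nu) (quantile mu0) (flow hw hw1 hx u0).
  exact: flow_strong_solution.
split => //.
- by move=> h hsol; exact: strong_solution_unique (convex_Fnu hw hnu) hsol sol.
- by move=> s s01 sW; exact: (@flow_explicit _ _ _ _ hw hw1 hx u0).
Qed.
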